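(* Let $b\ge 2$ be an integer and let $X$ be a real random variable with non-lattice distribution. Put $\phi(t):=E[e^{tX}]$ and suppose that $\phi$ reaches its infimum at a point $\rho>0$ lying in the interior of $\{t\in\mathbb{R}:\phi(t)<\infty\}$, and that the criticality condition $E[e^{\rho X}]=1/b$ holds. Let $Z$ be the total progeny of the $b$-ary branching random walk with step distribution $X$ killed below zero, and let $P^x$ be its law when the ancestor starts at $x\ge 0$. Then there exist two positive constants $C_1$ and $C_2$ such that for every $x\ge 0$ there is $n_0=n_0(x)$ such that for all $n\ge n_0$, $$C_1\,\frac{(1+x)e^{\rho x}}{n\ln^2(n)}\le P^x(Z>n)\le C_2\,\frac{(1+x)e^{\rho x}}{n\ln^2(n)}.$$
   Context: Let $\mathcal{T}$ be the infinite rooted $b$-ary tree (every vertex has exactly $b$ children). Attach to every vertex $u$ other than the root a random variable $X_u$, the $X_u$ being i.i.d. with the law of $X$. For vertices, $v\le u$ means that $v$ is an ancestor of $u$ or $v=u$. Under $P^x$, the position of $u$ is $S(u):=x+\sum_{v\le u,\,v\ne \mathrm{root}}X_v$; in particular the root is at $x$. A vertex $u$ is alive if $S(v)\ge 0$ for all $v\le u$. The total progeny is $$Z:=\#\{u\in\mathcal{T}: S(v)\ge 0\ \text{ for all } v\le u\}.$$ *)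

(* Defs.v *)
From mathcomp Require Import all_boot all_order all_algebra.
From mathcomp Require Import all_classical all_reals all_analysis.

Set Implicit Arguments.
Unset Strict Implicit.
Unset Printing Implicit Defensive.

Import Order.TTheory GRing.Theory Num.Theory.
Import numFieldNormedType.Exports.

Local Open Scope classical_set_scope.
Local Open Scope ring_scope.

(* Ulam-Harris labelling of the infinite rooted b-ary tree: a vertex is the
   word of the child indices read from the root, so that "v is an ancestor of
   u or v = u" is [prefix v u]. *)
Notation vertex b := (seq 'I_b).

Definition tree_root (b : nat) : vertex b := [::].
Arguments tree_root {b}.

Definition ancestor_or_self (b : nat) (v u : vertex b) : bool := prefix v u.

(* In the next three definitions [X] is one realization of the displacements;
   its value at the root is never used. *)
Definition position (R : realType) (b : nat) (x : R) (X : vertex b -> R)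
    (u : vertex b) : R :=
  x + \sum_(v \in [set v | ancestor_or_self v u /\ v <> tree_root]) X v.

Definition alive (R : realType) (b : nat) (x : R) (X : vertex b -> R)
    (u : vertex b) : Prop :=
  forall v : vertex b, ancestor_or_self v u -> 0 <= position x X v.

(* The total progeny may be +oo, hence the extended real codomain. *)
Definition total_progeny (R : realType) (b : nat) (x : R)
    (X : vertex b -> R) : \bar R :=
  counting [set u | alive x X u].

Definition mutually_independent (d : measure_display) (T : measurableType d)
    (R : realType) (P : probability T R) (I : eqType) (D : set I)
    (X : I -> {RV P >-> R}) : Prop :=
  forall (s : seq I) (B : I -> set R),
    uniq s -> (forall i, i \in s -> D i) -> (forall i, measurable (B i)) ->
    P (\bigcap_(i in [set` s]) (X i @^-1` B i))
      = (\prod_(i <- s) P (X i @^-1` B i))%E.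

Definition iid_with_law (d : measure_display) (T : measurableType d)
    (d' : measure_display) (T' : measurableType d') (R : realType)
    (P : probability T R) (P' : probability T' R) (I : eqType) (D : set I)
    (Xs : I -> {RV P >-> R}) (X : {RV P' >-> R}) : Prop :=
  mutually_independent D Xs /\
  (forall i, D i -> forall B : set R, measurable B ->
     distribution P (Xs i) B = distribution P' X B).

(* The law is carried by a coset a + h Z; the shift a is arbitrary, so this is
   weaker than being arithmetic (carried by h Z). *)
Definition lattice_distribution (d : measure_display) (T : measurableType d)
    (R : realType) (P : probability T R) (X : {RV P >-> R}) : Prop :=
  exists a h : R, 0 < h /\
    distribution P X (range (fun k : int => a + k%:~R * h)) = 1%E.

(* Main.v *)
Require Import Defs.
From HB Require Import structures.
From mathcomp Require Import all_boot all_order all_algebra.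
From mathcomp Require Import all_classical all_reals all_analysis.
From mathcomp Require Import finmap measurable_realfun.
From mathcomp Require Import ring lra.

(** Fix a level L and let N_L be the number of vertices whose whole ancestral
    path stays in [0, L].  Under the tilt b e^{rho X} the step becomes a centred
    walk with exponential moments, so many-to-one turns every first moment into
    an expectation of that walk killed outside [0, L].  Explicit super- and
    subharmonic functions (affine functions corrected by exponentials, which
    absorb the overshoots) then give, uniformly in L,
      P(some vertex exceeds L) <= C (1+x) e^{rho x} / (L e^{rho L}),
      E[N_L^2] <= C (1+x) e^{rho x} e^{rho L} / L^3,
      E[N_L - N_{L-1-K}] >= c (1+x) e^{rho x} / L^2  (K a constant).
    Off the first event Z = N_L, so with e^{rho L} = n ln n the first two bounds
    and Chebyshev give the upper estimate.  For the lower one put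
    e^{rho L} = M n ln n with M large: D = N_L - N_{L-1-K} vanishes unless level
    L-1-K is exceeded, so D <= n contributes at most n P(level exceeded), a small
    fraction of E[D], and Cauchy-Schwarz bounds P(D > n) from below by
    E[D]^2 / E[N_L^2]. *)

Import Order.TTheory GRing.Theory Num.Theory.
Import numFieldNormedType.Exports.

Local Open Scope classical_set_scope.
Local Open Scope ring_scope.

(** E[N_L] alone cannot give the lower bound: it stays of order e^{rho x} and is carried by
    populations that never come near L, so setting it against E[N_L^2] says nothing about {Z > n}.
    Subtracting N_{L-1-K} removes these populations and lowers the mean to order (1+x) e^{rho x} /
    L^2. The quotient E[D]^2 / E[N_L^2] then has order (1+x) e^{rho x} / (L e^{rho L}), the same as
    the crossing bound, and with L of order ln n both become (1+x) e^{rho x} / (n ln^2 n). In the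
    upper estimate, e^{rho L} = n ln n is the value that balances the crossing bound against the
    Chebyshev term e^{rho L} / (n^2 L^3).

    No limit theorem for the killed walk is used. Every moment bound is an induction on the
    truncation depth k, comparing a moment with a barrier. The difficulty is that an affine
    function, harmonic for the centred walk, loses this property once it is cut off at the ends of
    the interval. The exponentials e^{th z} and e^{- th z} have tilted mean strictly above 1, which
    yields a gain at each step. Their squares grow faster and dominate the overshoots, and the
    constants are chosen so that the gain pays for these squares. *)

(** * Independence of disjoint blocks of coordinates *)

Section independence.
Context {d : measure_display} {T : measurableType d} {R : realType}.
Variable P : probability T R.

Section product.
Context {d1 d2 : measure_display} {T1 : measurableType d1}
  {T2 : measurableType d2} {U : T -> T1} {V : T -> T2}.
Hypotheses (mU : measurable_fun setT U) (mV : measurable_fun setT V).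
Hypothesis UV : forall A B, measurable A -> measurable B ->
  P (U @^-1` A `&` V @^-1` B) = (P (U @^-1` A) * P (V @^-1` B))%E.
Variable F : T1 * T2 -> \bar R.
Hypothesis mF : measurable_fun [set: T1 * T2] F.
Hypothesis F0 : forall z, (0 <= F z)%E.

(** The law of (U, V) and the product of the two laws agree on rectangles, hence everywhere; Tonelli
    does the rest. The targets are arbitrary measurable spaces, so a map may also be the identity of
    T into a coarser sigma-algebra. *)
Lemma indep_fubini :
  (\int[P]_w F (U w, V w) = \int[P]_w1 \int[P]_w2 F (U w1, V w2))%E.
Proof.
have mUV : measurable_fun setT (fun w => (U w, V w)) by exact/measurable_fun_pair.
pose u : {mfun T >-> T1} := HB.pack U (isMeasurableFun.Build _ _ _ _ _ mU).
pose v : {mfun T >-> T2} := HB.pack V (isMeasurableFun.Build _ _ _ _ _ mV).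
pose uv : {mfun T >-> (T1 * T2)%type} :=
  HB.pack (fun w => (U w, V w)) (isMeasurableFun.Build _ _ _ _ _ mUV).
have -> : (\int[P]_w F (U w, V w) = \int[distribution P uv]_z F z)%E.
  by rewrite ge0_integral_distribution.
have Puv A : measurable A ->
    (distribution P u \x distribution P v)%E A = distribution P uv A.
  apply: product_measure_unique => C D mC mD.
  by rewrite /distribution/= /pushforward /= -UV//; congr (P _); apply/seteqP; split.
rewrite (eq_measure_integral (distribution P u \x distribution P v)%E); last first.
  by move=> A mA _; exact: (esym (Puv A mA)).
rewrite fubini_tonelli1//.
rewrite ge0_integral_distribution; last 2 first.
- exact: measurable_fun_fubini_tonelli_F.
- by move=> x; apply: integral_ge0 => y _.
apply: eq_integral => w _ /=.
rewrite /fubini_F ge0_integral_distribution//.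
exact: (measurableT_comp mF (pair1_measurable _)).
Qed.

End product.

Context {I : eqType}.
Variable X : I -> {RV P >-> R}.

(** A pi-system generating the sigma-algebra of the coordinates in D; [mutually_independent] speaks
    of exactly these events. *)
Definition cylinder (D : set I) : set (set T) :=
  [set A | exists (s : seq I) (B : I -> set R),
    [/\ uniq s, forall i, i \in s -> D i, forall i, measurable (B i) &
        A = \bigcap_(i in [set` s]) (X i @^-1` B i)]].

Lemma cylinder_measurable D : cylinder D `<=` measurable.
Proof.
move=> _ [s [B [_ _ mB ->]]]; apply: fin_bigcap_measurable => //.
move=> i _; rewrite -[_ @^-1` _]setTI; exact: measurable_funP.
Qed.

Lemma cylinderT D : cylinder D setT.
Proof.
exists [::], (fun=> setT); split => //.
by apply/seteqP; split.
Qed.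

Lemma cylinder_setI D : setI_closed (cylinder D).
Proof.
move=> _ _ [s1 [B1 [u1 D1 m1 ->]]] [s2 [B2 [u2 D2 m2 ->]]].
exists (undup (s1 ++ s2)), (fun i => (if i \in s1 then B1 i else setT) `&`
  (if i \in s2 then B2 i else setT)); split.
- exact: undup_uniq.
- by move=> i; rewrite mem_undup mem_cat => /orP[/D1|/D2].
- by move=> i; apply: measurableI; case: ifP.
- apply/seteqP; split => [w [h1 h2] i /= _|w h].
    split; case: ifPn => // hi; [exact: h1|exact: h2].
  split=> i /= hi; have /= [] : ((if i \in s1 then B1 i else setT) `&`
      (if i \in s2 then B2 i else setT)) (X i w).
  + by apply: h; rewrite /= mem_undup mem_cat hi.
  + by rewrite hi.
  + by apply: h; rewrite /= mem_undup mem_cat hi orbT.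
  + by rewrite hi.
Qed.

Lemma cylinder_mem D i (B : set R) : D i -> measurable B ->
  cylinder D (X i @^-1` B).
Proof.
move=> Di mB; exists [:: i], (fun=> B); split => //.
  by move=> j; rewrite inE => /eqP ->.
apply/seteqP; split => [w Bw j /=|w].
  by rewrite inE => /eqP ->.
by apply; rewrite /= inE.
Qed.

Variable D0 : set I.
Hypothesis iX : mutually_independent D0 X.

(** Disjointness makes the concatenation of the two index lists duplicate free, so mutual
    independence applies to it and the product splits. *)
Lemma cylinder_indep D1 D2 : D1 `<=` D0 -> D2 `<=` D0 -> [disjoint D1 & D2] ->
  forall A1 A2, cylinder D1 A1 -> cylinder D2 A2 ->
  P (A1 `&` A2) = (P A1 * P A2)%E.
Proof.
move=> D10 D20 D12 _ _ [s1 [B1 [u1 sD1 m1 ->]]] [s2 [B2 [u2 sD2 m2 ->]]].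
rewrite !iX//; [|by move=> i /sD2/D20|by move=> i /sD1/D10].
have s12 i : i \in s1 -> i \in s2 -> False.
  move=> /sD1 h1 /sD2 h2.
  by move/disj_set2P: D12 => /seteqP[+ _] => /(_ i); apply.
pose B i := if i \in s1 then B1 i else B2 i.
have -> : (\bigcap_(i in [set` s1]) X i @^-1` B1 i) `&`
    (\bigcap_(i in [set` s2]) X i @^-1` B2 i) =
    \bigcap_(i in [set` s1 ++ s2]) X i @^-1` B i.
  apply/seteqP; split => [w [h1 h2] i /=|w h].
    rewrite mem_cat /B; case: ifPn => [hi _|_ hi]; [exact: h1|exact: h2].
  split=> i /= hi; have := h i; rewrite /= mem_cat hi ?orbT /B.
    by rewrite hi; exact.
  by case: ifPn => [/s12/(_ hi)//|_]; exact.
rewrite iX.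
- rewrite big_cat/=; congr (_ * _)%E; rewrite !big_seq; apply: eq_bigr => i hi.
    by rewrite /B hi.
  by rewrite /B; case: ifPn => // /s12/(_ hi).
- rewrite cat_uniq u1 u2 andbT /=; apply/hasPn => i h2; apply/negP => h1.
  exact: s12 h1 h2.
- by move=> i; rewrite mem_cat => /orP[/sD1/D10|/sD2/D20].
- by move=> i; rewrite /B; case: ifP.
Qed.

(** For fixed A2, the finite measures A |-> P (A [&] A2) and P A2 * P agree on the pi-system G1,
    hence on the sigma-algebra that it generates. *)
Let indep_ext (G1 G2 : set (set T)) : G1 `<=` measurable -> G2 `<=` measurable ->
  setI_closed G1 -> G1 setT ->
  (forall A1 A2, G1 A1 -> G2 A2 -> P (A1 `&` A2) = (P A1 * P A2)%E) ->
  forall A1 A2, <<s G1 >> A1 -> G2 A2 -> P (A1 `&` A2) = (P A1 * P A2)%E.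
Proof.
move=> G1m G2m G1I G1T ind A1 A2 + GA2.
have mA2 := G2m _ GA2.
have p0 : 0 <= fine (P A2) by rewrite fine_ge0.
have pE : P A2 = (fine (P A2))%:E by rewrite fineK// fin_num_measure.
move=> GA1.
have /= := @g_sigma_algebra_measure_unique _ R T G1 G1m (fun=> setT) (fun=> G1T)
  _ (mrestr P mA2) (mscale (NngNum p0) P) G1I _ _ A1 GA1.
rewrite /mrestr/= /mscale /= -pE muleC; apply => //.
- by rewrite bigcup_const.
- by move=> B GB; rewrite ind// muleC.
- by move=> _; rewrite (le_lt_trans (probability_le1 _ _)) ?ltry// setTI.
Qed.

(** [indep_ext] is applied to each side in turn: first to extend D1 against cylinders of D2, then to
    extend D2. *)
Lemma sigma_cylinder_indep D1 D2 : D1 `<=` D0 -> D2 `<=` D0 ->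
  [disjoint D1 & D2] ->
  forall A1 A2, <<s cylinder D1 >> A1 -> <<s cylinder D2 >> A2 ->
  P (A1 `&` A2) = (P A1 * P A2)%E.
Proof.
move=> D10 D20 D12 A1 A2 h1 h2.
rewrite setIC muleC.
have m1 := @cylinder_measurable D1; have m2 := @cylinder_measurable D2.
apply: (@indep_ext (cylinder D2) <<s cylinder D1 >>) => //.
- exact: smallest_sub (@sigma_algebra_measurable _ T) m1.
- exact: cylinder_setI.
- exact: cylinderT.
- move=> B2 B1 hB2 hB1; rewrite setIC muleC.
  apply: (@indep_ext (cylinder D1) (cylinder D2)) => //.
  + exact: cylinder_setI.
  + exact: cylinderT.
  + exact: cylinder_indep.
Qed.

End independence.

(** * Moments of branching functionals *)

(* The particle at v sits at y (so [X v] is not read).  With phi = chi = \1_A this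
   counts the vertices less than k generations below v whose path stays in A;
   with phi = \1_]L, +oo[ and chi = \1_[0, L] it counts first passages above L. *)
Fixpoint branch {R : realType} {b : nat} (phi chi : R -> R) (k : nat) (y : R)
    (v : vertex b) (X : vertex b -> R) : R :=
  if k is k'.+1 then
    phi y + chi y * \sum_(i < b) branch phi chi k' (y + X (rcons v i)) (rcons v i) X
  else 0.

Definition subtree {b : nat} (v : vertex b) : set (vertex b) :=
  [set u | prefix v u].

(** These are the coordinates that [branch] started at v can read; v itself is left out because its
    displacement is already part of the starting position. *)
Definition descendants {b : nat} (v : vertex b) : set (vertex b) :=
  [set u | prefix v u /\ u <> v].

Section genealogy.
Context {b : nat}.
Implicit Types (v u : vertex b) (i j : 'I_b).

Lemma rcons_neq v i : rcons v i <> v.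
Proof. by move=> /(congr1 size)/eqP; rewrite size_rcons eqn_leq ltnn. Qed.

Lemma rcons_neq0 v i : rcons v i <> [::].
Proof. by case: v. Qed.

Lemma descendants_child v i : descendants v (rcons v i).
Proof. by split; [exact: prefix_rcons|exact: rcons_neq]. Qed.

Lemma subtree_child v i : subtree (rcons v i) `<=` descendants v.
Proof.
move=> u /= h; split; first exact: prefix_trans (prefix_rcons v i) h.
by move=> uv; move: h; rewrite uv => /size_prefix; rewrite size_rcons ltnn.
Qed.

Lemma descendants_sub v : descendants v `<=` subtree v.
Proof. by move=> u []. Qed.

Lemma subtree_root v : v <> [::] -> subtree v `<=` [set u | u <> tree_root].
Proof. by case: v => // i v _ u + u0; rewrite u0. Qed.

Lemma subtree_disjoint v i j : i != j ->
  [disjoint subtree (rcons v i) & subtree (rcons v j)].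
Proof.
move=> ij; apply/disj_set2P/seteqP; split => // u [/= /prefixP[s1 ->]].
rewrite !cat_rcons => /prefixP[s2]; rewrite cat_rcons.
move/eqP; rewrite eqseq_cat// => /andP[_ /eqP[E _]].
by move: ij; rewrite E eqxx.
Qed.

Lemma vertex_descendants_disjoint v :
  [disjoint [set v] & descendants v].
Proof. by apply/disj_set2P/seteqP; split => // u [/= -> []]. Qed.

End genealogy.

Lemma branch_ge0 {R : realType} {b : nat} {phi chi : R -> R} k y (v : vertex b) X :
  (forall y, 0 <= phi y) -> (forall y, 0 <= chi y) -> 0 <= branch phi chi k y v X.
Proof.
move=> p0 c0; elim: k y v => //= k IH y v.
by rewrite addr_ge0// mulr_ge0// sumr_ge0.
Qed.

(** The starting position f and the space S are left free so that this covers a product with R, a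
    random displacement of the root, and T with the sigma-algebra of a block of coordinates. *)
Lemma measurable_branch {R : realType} {b : nat} {phi chi : R -> R}
    {d : measure_display} {S : measurableType d} {X : vertex b -> S -> R}
    {v : vertex b} k (f : S -> R) :
  measurable_fun setT phi -> measurable_fun setT chi -> measurable_fun setT f ->
  (forall u, descendants v u -> measurable_fun setT (X u)) ->
  measurable_fun setT (fun s => branch phi chi k (f s) v (X^~ s)).
Proof.
move=> mp mc; elim: k v f => [|k IH] v f mf mX /=; first exact: measurable_cst.
apply: measurable_funD; first exact: measurableT_comp mp mf.
apply: measurable_funM; first exact: measurableT_comp mc mf.
apply: measurable_sum => i; apply: IH.
  by apply: measurable_funD => //; exact/mX/descendants_child.
by move=> u /descendants_sub/subtree_child/mX.
Qed.

Section moments.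
Context {R : realType} {b : nat}.
Context {d0 : measure_display} {T0 : measurableType d0} {P0 : probability T0 R}.
Variable X : {RV P0 >-> R}.
Context {d : measure_display} {T : measurableType d} {P : probability T R}.
Variable Xs : vertex b -> {RV P >-> R}.
Hypothesis hXs : iid_with_law [set u : vertex b | u <> tree_root] Xs X.
Variables phi chi : R -> R.
Hypotheses (mphi : measurable_fun setT phi) (mchi : measurable_fun setT chi).
Hypotheses (phi0 : forall y, 0 <= phi y) (chi0 : forall y, 0 <= chi y).

Local Notation N k y v w := (branch phi chi k y v (fun u => Xs u w)).

Lemma measurable_branchXs k y v : measurable_fun setT (fun w => N k y v w).
Proof.
by apply: measurable_branch => // u _; exact: measurable_funPT.
Qed.

Lemma measurable_branch_child k y v i :
  measurable_fun setT (fun w => N k (y + Xs (rcons v i) w) (rcons v i) w).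
Proof.
apply: measurable_branch => //; first exact/measurable_funD.
Qed.

(* T with the sigma-algebra of the coordinates in D: [indep_fubini] is applied to
   the identity maps from T to such types. *)
Let TD (D : set (vertex b)) := g_sigma_algebraType (cylinder P Xs D).

Let measurable_Xs (D : set (vertex b)) u : D u ->
  measurable_fun setT (Xs u : TD D -> R).
Proof.
move=> Du _ B mB; rewrite setTI; apply: sub_sigma_algebra.
exact: cylinder_mem.
Qed.

Let measurable_idD (D : set (vertex b)) : measurable_fun setT (fun w : T => w : TD D).
Proof.
move=> _ B mB; rewrite setTI preimage_id.
exact: (smallest_sub (@sigma_algebra_measurable _ T)
  (@cylinder_measurable _ _ _ P _ Xs D)).
Qed.

Lemma measurable_branch_integral (g : R -> \bar R) k v :
  measurable_fun setT g -> (forall z : R, 0 <= z -> (0 <= g z)%E) ->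
  measurable_fun setT (fun z => \int[P]_w g (N k z v w))%E.
Proof.
move=> mg g0.
have mF : measurable_fun setT
    (fun p : R * T => g (branch phi chi k p.1 v (fun u => Xs u p.2))).
  have mXD u : descendants v u -> measurable_fun setT (fun p : R * T => Xs u p.2).
    by move=> _; exact: measurableT_comp (measurable_funPT (Xs u)) measurable_snd.
  exact: measurableT_comp mg (measurable_branch k _ mphi mchi measurable_fst mXD).
apply: (measurable_fun_fubini_tonelli_F (m2 := P) _ mF) => p.
exact/g0/branch_ge0.
Qed.

(** One-step Markov property: the displacement of the child is independent of the displacements
    below it and has the law of X. The function g serves for the first moment and for the square. *)
Lemma branch_child_mean (g : R -> \bar R) k y v i :
  measurable_fun setT g -> (forall z : R, 0 <= z -> (0 <= g z)%E) ->
  (\int[P]_w g (N k (y + Xs (rcons v i) w) (rcons v i) w) =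
   \int[P0]_w0 \int[P]_w g (N k (y + X w0) (rcons v i) w))%E.
Proof.
move=> mg g0; set vi := rcons v i.
have gN0 z Y : (0 <= g (branch phi chi k z vi Y))%E by apply/g0/branch_ge0.
have mF (D : set (vertex b)) : descendants vi `<=` D ->
    measurable_fun setT
    (fun p : R * TD D => g (branch phi chi k (y + p.1) vi (fun u => Xs u p.2))).
  move=> sD; have mXD u : descendants vi u ->
      measurable_fun setT (fun p : R * TD D => Xs u p.2).
    by move=> /sD Du; exact: measurableT_comp (measurable_Xs _ _ Du) measurable_snd.
  have mf : measurable_fun setT (fun p : R * TD D => y + p.1).
    exact: measurable_funD.
  exact: measurableT_comp mg (measurable_branch k _ mphi mchi mf mXD).
have := @indep_fubini _ _ _ P _ _ R (TD (descendants vi)) (Xs vi) (fun w => w)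
  (measurable_funPT (Xs vi)) (@measurable_idD _) _
  (fun p => g (branch phi chi k (y + p.1) vi (fun u => Xs u p.2))) (mF _ (fun x => id)) (fun=> gN0 _ _).
move=> -> /=; last first.
  move=> A B mA mB; rewrite preimage_id.
  apply: (sigma_cylinder_indep _ _ _ hXs.1 [set vi] (descendants vi)) => //.
  - by move=> _ ->; exact: rcons_neq0.
  - exact/(subset_trans (@descendants_sub _ _))/subtree_root/rcons_neq0.
  - exact: vertex_descendants_disjoint.
  - by apply: sub_sigma_algebra; exact: cylinder_mem.
pose f z := (\int[P]_w g (N k (y + z) vi w))%E.
have mf : measurable_fun setT f.
  apply: (measurableT_comp (measurable_branch_integral g k vi mg g0)).
  exact: measurable_funD.
have f0 z : (0 <= f z)%E by apply: integral_ge0.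
transitivity (\int[distribution P (Xs vi)]_z f z)%E.
  by rewrite ge0_integral_distribution.
transitivity (\int[distribution P0 X]_z f z)%E.
  apply: eq_measure_integral => A mA _; apply: hXs.2 => //; exact: rcons_neq0.
by rewrite ge0_integral_distribution.
Qed.

(** Two sibling subtrees, each with the edge leading to it, are disjoint blocks of coordinates. *)
Lemma branch_cross_mean k y v i j : i != j ->
  (\int[P]_w (N k (y + Xs (rcons v i) w) (rcons v i) w *
              N k (y + Xs (rcons v j) w) (rcons v j) w)%:E =
   \int[P]_w (N k (y + Xs (rcons v i) w) (rcons v i) w)%:E *
   \int[P]_w (N k (y + Xs (rcons v j) w) (rcons v j) w)%:E)%E.
Proof.
move=> ij.
pose TS i := TD (subtree (rcons v i)).
have mc l : measurable_fun setT
    (fun w : TS l => branch phi chi k (y + Xs (rcons v l) w) (rcons v l) (fun u => Xs u w)).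
  have mXD u : descendants (rcons v l) u -> measurable_fun setT (Xs u : TS l -> R).
    by move=> /descendants_sub; exact: measurable_Xs.
  have mf : measurable_fun setT (fun w : TS l => y + Xs (rcons v l) w).
    by apply: measurable_funD => //; apply: measurable_Xs; exact: prefix_refl.
  exact: measurable_branch k _ mphi mchi mf mXD.
have mGG : measurable_fun setT (fun p : TS i * TS j =>
   (branch phi chi k (y + Xs (rcons v i) p.1) (rcons v i) (fun u => Xs u p.1) *
    branch phi chi k (y + Xs (rcons v j) p.2) (rcons v j) (fun u => Xs u p.2))%:E).
  apply/measurable_EFinP; apply: measurable_funM.
    exact: measurableT_comp (mc i) measurable_fst.
  exact: measurableT_comp (mc j) measurable_snd.
have G0 p : (0 <= (branch phi chi k (y + Xs (rcons v i) p.1) (rcons v i) (fun u => Xs u p.1) *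
    branch phi chi k (y + Xs (rcons v j) p.2) (rcons v j) (fun u => Xs u p.2))%:E)%E.
  by rewrite lee_fin mulr_ge0// branch_ge0.
have := @indep_fubini _ _ _ P _ _ (TS i) (TS j) (fun w => w) (fun w => w)
  (@measurable_idD _) (@measurable_idD _) _ _ mGG (fun=> G0 _).
move=> -> /=; last first.
  move=> A B mA mB; rewrite !preimage_id.
  apply: (sigma_cylinder_indep _ _ _ hXs.1 (subtree (rcons v i)) (subtree (rcons v j))) => //.
  - exact/subtree_root/rcons_neq0.
  - exact/subtree_root/rcons_neq0.
  - exact: subtree_disjoint.
under eq_integral => w1 _.
  under eq_integral do rewrite EFinM.
  rewrite ge0_integralZl//; last 3 first.
  - exact/measurable_EFinP/measurable_branch_child.
  - by move=> x _; rewrite lee_fin branch_ge0.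
  - by rewrite lee_fin branch_ge0.
  over.
rewrite ge0_integralZr//.
- exact/measurable_EFinP/measurable_branch_child.
- by move=> x _; rewrite lee_fin branch_ge0.
- by apply: integral_ge0 => x _; rewrite lee_fin branch_ge0.
Qed.

Lemma branch_mean k y v :
  (\int[P]_w (N k.+1 y v w)%:E = (phi y)%:E + (chi y)%:E *
    \sum_(i < b) \int[P0]_w0 \int[P]_w (N k (y + X w0) (rcons v i) w)%:E)%E.
Proof.
rewrite /=; under eq_integral do rewrite EFinD EFinM -sumEFin.
have c0 (i : 'I_b) w : (0 <= (N k (y + Xs (rcons v i) w) (rcons v i) w)%:E)%E.
  by rewrite lee_fin branch_ge0.
have mc (i : 'I_b) : measurable_fun setT
    (fun w => (N k (y + Xs (rcons v i) w) (rcons v i) w)%:E).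
  exact/measurable_EFinP/measurable_branch_child.
have ms : measurable_fun setT
    (fun w => \sum_(i < b) (N k (y + Xs (rcons v i) w) (rcons v i) w)%:E)%E.
  exact: emeasurable_sum.
rewrite ge0_integralD//; last 3 first.
- by move=> w _; rewrite lee_fin.
- by move=> w _; rewrite mule_ge0// ?lee_fin// sume_ge0.
- exact: measurable_funeM.
rewrite integral_cst//= probability_setT mule1; congr (_ + _)%E.
rewrite ge0_integralZl//; last 2 first.
- by move=> w _; rewrite sume_ge0.
- by rewrite lee_fin.
rewrite ge0_integral_sum//; congr (_ * _)%E; apply: eq_bigr => i _.
by apply: (branch_child_mean EFin) => // z z0; rewrite lee_fin.
Qed.

End moments.

Section second_moment.
Context {R : realType} {b : nat}.
Context {d0 : measure_display} {T0 : measurableType d0} {P0 : probability T0 R}.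
Variable X : {RV P0 >-> R}.
Context {d : measure_display} {T : measurableType d} {P : probability T R}.
Variable Xs : vertex b -> {RV P >-> R}.
Hypothesis hXs : iid_with_law [set u : vertex b | u <> tree_root] Xs X.
Variable A : set R.
Hypothesis mA : measurable A.

Local Notation N k y v w := (branch (\1_A) (\1_A) k y v (fun u => Xs u w)).

(** On A the count is 1 plus the children's counts. Squaring gives 1 + 2m, diagonal terms bounded by
    s, and off-diagonal terms, which factor by independence of siblings and total at most m^2. *)
Lemma branch_second_moment k y v (m s : R) :
  (\sum_(i < b) \int[P0]_w0 \int[P]_w (N k (y + X w0) (rcons v i) w)%:E <= m%:E)%E ->
  (\sum_(i < b) \int[P0]_w0 \int[P]_w (N k (y + X w0) (rcons v i) w ^+ 2)%:E <= s%:E)%E ->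
  (\int[P]_w (N k.+1 y v w ^+ 2)%:E <= (\1_A y * ((1 + m) ^+ 2 + s))%:E)%E.
Proof.
have mI : measurable_fun setT (\1_A : R -> R) by exact: measurable_indic.
have I0 z : 0 <= \1_A z :> R by rewrite indicE.
pose c i w := N k (y + Xs (rcons v i) w) (rcons v i) w.
have c0 i w : 0 <= c i w by exact: branch_ge0.
have mc i : measurable_fun setT (c i) by exact: measurable_branch_child.
have E1 i : (\int[P0]_w0 \int[P]_w (N k (y + X w0) (rcons v i) w)%:E =
    \int[P]_w (c i w)%:E)%E.
  rewrite -(branch_child_mean _ _ hXs _ _ mI mI I0 I0 EFin)//.
have E2 i : (\int[P0]_w0 \int[P]_w (N k (y + X w0) (rcons v i) w ^+ 2)%:E =
    \int[P]_w (c i w ^+ 2)%:E)%E.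
  rewrite -(branch_child_mean _ _ hXs _ _ mI mI I0 I0 (fun z => (z ^+ 2)%:E))//.
    exact/measurable_EFinP/measurable_funX.
  by move=> z; rewrite lee_fin sqr_ge0.
under eq_bigr do rewrite E1; under [X in (X <= s%:E)%E -> _]eq_bigr do rewrite E2.
move=> hm hs.
have m0 i : (0 <= \int[P]_w (c i w)%:E)%E by apply: integral_ge0 => w _; rewrite lee_fin.
have fm i : (\int[P]_w (c i w)%:E)%E \is a fin_num.
  rewrite ge0_fin_numE//; apply: le_lt_trans (ltry m); apply: le_trans hm.
  by rewrite (bigD1 i)//= leeDl// sume_ge0.
pose mu i := fine (\int[P]_w (c i w)%:E)%E.
have muE i : (\int[P]_w (c i w)%:E = (mu i)%:E)%E by rewrite fineK.
have mu0 i : 0 <= mu i by rewrite fine_ge0.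
have mc2 i j : measurable_fun setT (fun w => (c i w * c j w)%:E).
  by apply/measurable_EFinP; exact: measurable_funM.
have cc0 i j w : (0 <= (c i w * c j w)%:E)%E by rewrite lee_fin mulr_ge0.
have mc1 i : measurable_fun setT (fun w => (c i w)%:E) by exact/measurable_EFinP.
have c0E i w : (0 <= (c i w)%:E)%E by rewrite lee_fin.
have expand : (\int[P]_w ((1 + \sum_(i < b) c i w) ^+ 2)%:E <= ((1 + m) ^+ 2 + s)%:E)%E.
  have -> : (\int[P]_w ((1 + \sum_(i < b) c i w) ^+ 2)%:E =
      \int[P]_w (1 + (\sum_(i < b) (2 * c i w)%:E +
        \sum_(i < b) \sum_(j < b) (c i w * c j w)%:E)))%E.
    apply: eq_integral => w _; rewrite sumEFin.
    under [X in (1%:E + (_ + X))%E]eq_bigr do rewrite sumEFin.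
    rewrite sumEFin -!EFinD; congr EFin.
    rewrite -mulr_sumr; under [X in _ = _ + (_ + X)]eq_bigr do rewrite -mulr_sumr.
    by rewrite -mulr_suml; ring.
  have mcc i : measurable_fun setT (fun w => \sum_(j < b) (c i w * c j w)%:E)%E.
    exact: emeasurable_sum.
  have m2c i : measurable_fun setT (fun w => (2 * c i w)%:E).
    by apply/measurable_EFinP; exact: measurable_funM.
  have c20 i w : (0 <= (2 * c i w)%:E)%E by rewrite lee_fin mulr_ge0.
  rewrite ge0_integralD//; last 2 first.
  - by move=> w _; rewrite adde_ge0// sume_ge0// => i _; rewrite sume_ge0.
  - by apply: emeasurable_funD; exact: emeasurable_sum.
  rewrite integral_cst//= probability_setT mul1e.
  rewrite ge0_integralD//; last 4 first.
  - by move=> w _; rewrite sume_ge0.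
  - exact: emeasurable_sum.
  - by move=> w _; rewrite sume_ge0// => i _; rewrite sume_ge0.
  - exact: emeasurable_sum.
  rewrite !ge0_integral_sum//; last by move=> i w _; rewrite sume_ge0.
  under eq_bigr => i _.
    under eq_integral do rewrite EFinM.
    rewrite ge0_integralZl// muE -EFinM; over.
  under [X in (_ + (_ + X))%E]eq_bigr => i _.
    rewrite ge0_integral_sum// (bigD1 i)//=.
    under [X in (_ + X)%E]eq_bigr => j ji.
      rewrite (branch_cross_mean _ _ hXs _ _ mI mI I0 I0)// 1?eq_sym//.
      rewrite -!/(c _ _) !muE -EFinM; over.
    rewrite sumEFin; over.
  rewrite big_split/= !sumEFin.
  have hs' : (\sum_(i < b) \int[P]_w (c i w * c i w)%:E <= s%:E)%E.
    by apply: le_trans hs; apply: lee_sum => i _; under eq_integral do rewrite -expr2.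
  apply: (le_trans (leeD2l _ (leeD2l _ (leeD2r _ hs')))).
  rewrite -!EFinD lee_fin.
  have hM : \sum_(i < b) mu i <= m.
    by rewrite -lee_fin -sumEFin; apply: le_trans hm; apply: lee_sum => i _; rewrite muE.
  have M0 : 0 <= \sum_(i < b) mu i by exact: sumr_ge0.
  have hMM : \sum_(i < b) \sum_(j < b | j != i) mu i * mu j <= (\sum_(i < b) mu i) ^+ 2.
    rewrite expr2 mulr_suml; apply: ler_sum => i _; rewrite mulr_sumr.
    by rewrite [leRHS](bigD1 i)//= lerDr mulr_ge0.
  by rewrite -mulr_sumr; nra.
rewrite /= indicE; case: (y \in A).
  rewrite mul1r; apply: le_trans expand; rewrite le_eqVlt; apply/orP; left; apply/eqP.
  by apply: eq_integral => w _; rewrite mul1r.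
rewrite mul0r; under eq_integral do rewrite mul0r addr0 expr0n/=.
by rewrite integral0.
Qed.

End second_moment.

(** * The progeny as a limit of branching functionals *)

Section progeny.
Context {R : realType} {b : nat}.
Implicit Types (v u : vertex b) (X : vertex b -> R).

Lemma prefix_rconsE v u (i : 'I_b) :
  prefix v (rcons u i) = (v == rcons u i) || prefix v u.
Proof.
apply/idP/idP => [|/orP[/eqP->|h]]; last 2 first.
- exact: prefix_refl.
- exact: prefix_trans h (prefix_rcons _ _).
case/prefixP => s; case/lastP: s => [|s j]; first by rewrite cats0 => ->; rewrite eqxx.
by rewrite -rcons_cat => /rcons_inj[-> _]; rewrite prefix_prefix orbT.
Qed.

Lemma prefix_childP v u :
  reflect (u = v \/ exists i, prefix (rcons v i) u) (prefix v u).
Proof.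
apply: (iffP idP) => [/prefixP[[|i s] ->]|[->|[i]]].
- by left; rewrite cats0.
- by right; exists i; rewrite -cat_rcons prefix_prefix.
- exact: prefix_refl.
- exact/prefix_trans/prefix_rcons.
Qed.

Lemma position_root x X : position x X [::] = x.
Proof.
rewrite /position fsbig1 ?addr0// => v [].
by rewrite /ancestor_or_self prefixs0 => /eqP.
Qed.

Lemma position_rcons x X u i :
  position x X (rcons u i) = position x X u + X (rcons u i).
Proof.
rewrite /position (fsbigD1 (rcons u i)) /=; last 2 first.
- apply: (@sub_finite_set _ _ ((fun n => take n (rcons u i)) @` `I_(size u).+2)).
    move=> v [/= vu _]; exists (size v).
      by rewrite /= ltnS; have := size_prefix vu; rewrite size_rcons.
    by apply/eqP; rewrite -prefixE.
  exact/finite_image/finite_II.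
- by split; [exact: prefix_refl|exact: rcons_neq0].
rewrite (addrC (X _)) addrA; congr (_ + _ + _).
congr (\sum_(_ \in _) _); apply/seteqP; split => v /=.
  rewrite /ancestor_or_self prefix_rconsE => -[[/orP[/eqP//|vu] v0] _].
  by split.
rewrite /ancestor_or_self prefix_rconsE => -[vu v0].
split; first by rewrite vu orbT.
by move=> E; have := size_prefix vu; rewrite E size_rcons ltnn.
Qed.

Lemma alive_prefix x X v u : prefix v u -> alive x X u -> alive x X v.
Proof. by move=> vu au w wv; apply/au/(prefix_trans wv). Qed.

Lemma alive_rcons x X u i : alive x X u ->
  (alive x X (rcons u i) <-> 0 <= position x X (rcons u i)).
Proof.
move=> au; split => [|p0 v]; first by apply; exact: prefix_refl.
rewrite /ancestor_or_self prefix_rconsE => /orP[/eqP-> //|]; exact: au.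
Qed.

Lemma alive_root x X : alive x X [::] <-> 0 <= position x X [::].
Proof.
split=> [|p0 v]; first by apply; exact: prefix_refl.
by rewrite /ancestor_or_self prefixs0 => /eqP ->.
Qed.

(** The enumeration stops at the first dead vertex, so its length obeys the recursion of
    [branch]. *)
Fixpoint alive_seq x X k v : seq (vertex b) :=
  if k is k'.+1 then
    if `[< alive x X v >]
    then v :: flatten [seq alive_seq x X k' (rcons v i) | i <- enum 'I_b] else [::]
  else [::].

Lemma mem_alive_seq x X k v u : u \in alive_seq x X k v <->
  [/\ alive x X u, prefix v u & (size u < size v + k)%N].
Proof.
elim: k v => [|k IH] v /=.
  split => // -[_ /size_prefix h1]; rewrite addn0 => h2; by rewrite ltnNge h1 in h2.
case: asboolP => av; last first.
  by split => // -[au vu _]; case: av; exact: alive_prefix vu au.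
rewrite inE; split => [/orP[/eqP ->|/flatten_mapP[i _ /IH[au iu si]]]|].
- by split => //; [exact: prefix_refl|rewrite addnS ltnS leq_addr].
- split => //; first exact: prefix_trans (prefix_rcons _ _) iu.
  by rewrite addnS -addSn -(size_rcons v i).
- case=> au /prefix_childP[->|[i iu]] su; first by rewrite eqxx.
  apply/orP; right; apply/flatten_mapP; exists i; first by rewrite mem_enum.
  by apply/IH; split => //; rewrite size_rcons addSn -addnS.
Qed.

Lemma alive_seq_uniq x X k v : uniq (alive_seq x X k v).
Proof.
elim: k v => //= k IH v; case: asboolP => // av /=.
apply/andP; split.
  apply/negP => /flatten_mapP[i _] /mem_alive_seq[_ /size_prefix].
  by rewrite size_rcons ltnn.
have : uniq (enum 'I_b) by exact: enum_uniq.
elim: (enum 'I_b) => //= i s IHs /andP[is_ us].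
rewrite cat_uniq IH IHs// andbT; apply/hasPn => u /flatten_mapP[j js] /mem_alive_seq[_ ju _].
apply/negP => /mem_alive_seq[_ iu _].
have ij : i != j by apply: contraNneq is_ => ->.
by have /disj_set2P/seteqP[/(_ u) + _] := subtree_disjoint v i j ij; apply.
Qed.

(** The hypothesis says that v is not cut off by one of its strict ancestors. It holds at the root
    and passes from an alive vertex to its children. *)
Lemma size_alive_seq x X k v : (alive x X v <-> 0 <= position x X v) ->
  (size (alive_seq x X k v))%:R =
  branch \1_[set y : R | 0 <= y] \1_[set y : R | 0 <= y] k (position x X v) v X.
Proof.
elim: k v => //= k IH v hv; rewrite indicE.
case: asboolP => [av|nav]; last first.
  by rewrite memNset ?mul0r ?addr0// => /hv.
rewrite mem_set ?mul1r; last exact/hv.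
rewrite /= -add1n natrD; congr (_ + _).
rewrite size_flatten /shape -map_comp sumnE big_map natr_sum big_enum/=.
apply: eq_bigr => i _; rewrite -position_rcons; apply: IH.
exact: alive_rcons.
Qed.

(** More than n alive vertices, finite or infinite in number, are already witnessed by a finite
    list, hence within a finite depth. *)
Lemma total_progeny_gt x X (n : nat) :
  (n%:R%:E < total_progeny x X)%E <->
  exists k, n%:R < branch \1_[set y : R | 0 <= y] \1_[set y : R | 0 <= y] k x [::] X.
Proof.
have sz k := size_alive_seq x X k [::] (alive_root x X).
rewrite position_root in sz.
rewrite /total_progeny /counting; set Z := [set u | alive x X u].
split=> [h|[k]].
  have [s [us sZ ns]] : exists s : seq (vertex b),
      [/\ uniq s, forall u, u \in s -> Z u & (n < size s)%N].
    move: h; case: asboolP => [fZ|iZ].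
      rewrite lte_fin ltr_nat => h.
      exists (enum_fset (fset_set Z)); split => //; first exact: fset_uniq.
      by move=> u; rewrite in_fset_set// => /set_mem.
    move=> _; have [B BZ Bn] := infinite_set_fset n.+1 iZ.
    by exists (enum_fset B); split => //; first exact: fset_uniq.
  exists (\max_(u <- s) size u).+1; rewrite -sz ltr_nat (leq_trans ns)//.
  apply: uniq_leq_size => // u us'; apply/mem_alive_seq; split.
  - exact: sZ.
  - by case: u {us'}.
  - by rewrite add0n ltnS; exact: leq_bigmax_seq.
rewrite -sz ltr_nat => nk; case: asboolP => [fZ|_]; last exact: ltry.
rewrite lte_fin ltr_nat (leq_trans nk)// uniq_leq_size// ?alive_seq_uniq//.
by move=> u /mem_alive_seq[au _ _]; rewrite in_fset_set// mem_set.
Qed.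

Lemma le_branch (phi chi phi' chi' : R -> R) k y v X :
  (forall z, 0 <= phi z <= phi' z) -> (forall z, 0 <= chi z <= chi' z) ->
  branch phi chi k y v X <= branch phi' chi' k y v X.
Proof.
move=> hp hc; elim: k y v => //= k IH y v.
have /andP[_ p] := hp y; have /andP[c0 c] := hc y.
apply: lerD => //; apply: ler_pM => //; last exact: ler_sum.
apply: sumr_ge0 => i _; apply: branch_ge0 => z.
  by have /andP[] := hp z.
by have /andP[] := hc z.
Qed.

Lemma branch_le_depth (phi chi : R -> R) k y v X :
  (forall z, 0 <= phi z) -> (forall z, 0 <= chi z) ->
  branch phi chi k y v X <= branch phi chi k.+1 y v X.
Proof.
move=> p0 c0; elim: k y v => [|k IH] y v; first by rewrite branch_ge0.
by rewrite [leLHS]/= [leRHS]/= lerD2l ler_wpM2l// ler_sum.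
Qed.

(** Since A contains [0, L] and lies in the half-line, the two counts can only differ after some
    path has passed above L from inside [0, L]. A is the half-line for the upper tail and a longer
    interval for the lower one. *)
Lemma branch_confined (A : set R) (L : R) k y v X :
  `[0, L]%classic `<=` A -> A `<=` [set y | 0 <= y] ->
  branch \1_A \1_A k y v X = branch \1_`[0, L]%classic \1_`[0, L]%classic k y v X \/
  1 <= branch \1_`]L, +oo[%classic \1_`[0, L]%classic k y v X.
Proof.
move=> LA A0; elim: k y v => [|k IH] y v; first by left.
rewrite /= !indicE.
have [y0|y0] := ltP y 0.
  have nL : (y \in `[0, L]%classic) = false.
    by apply: memNset; rewrite /= in_itv/= leNgt y0.
  have nA : (y \in A) = false by apply: memNset => /A0 /=; rewrite leNgt y0.
  by left; rewrite nL nA !mul0r.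
have [Ly|yL] := ltP L y.
  have nL : (y \in `[0, L]%classic) = false.
    by apply: memNset; rewrite /= in_itv/= (leNgt y) Ly andbF.
  have yL : (y \in `]L, +oo[%classic) by apply: mem_set; rewrite /= in_itv/= Ly.
  by right; rewrite nL yL mul0r addr0.
have yI : `[0, L]%classic y by rewrite /= in_itv/= y0.
rewrite (mem_set yI) (mem_set (LA _ yI)) memNset ?add0r ?mul1r; last first.
  by rewrite /= in_itv/= andbT ltNge yL.
have [h|] := pselect (forall i : 'I_b, branch \1_A \1_A k (y + X (rcons v i)) (rcons v i) X =
    branch \1_`[0, L]%classic \1_`[0, L]%classic k (y + X (rcons v i)) (rcons v i) X).
  by left; congr (_ + _); apply: eq_bigr => i _.
move=> /existsNP[i hi]; right.
rewrite (bigD1 i)//=; case: (IH (y + X (rcons v i)) (rcons v i)) => // h1.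
rewrite (le_trans h1)// lerDl sumr_ge0// => j _.
by apply: branch_ge0 => z; rewrite indicE.
Qed.

End progeny.

(** * Barriers for a centred walk killed outside an interval *)

Ltac measurable_expr := repeat first
  [ exact: measurable_cst | exact: measurable_id | exact: measurable_expR
  | apply: measurable_funB | apply: measurable_funD | apply: measurable_funM
  | apply: measurable_funX
  | match goal with |- measurable_fun _ (fun x => expR (@?f x)) =>
      apply: (@measurableT_comp _ _ _ _ _ _ expR _ f); first exact: measurable_expR
    end
  | match goal with |- measurable_fun _ (fun x => - (@?f x)) =>
      apply: (@measurable_funN _ _ _ _ f)
    end].

Section weighted_mean.
Context {R : realType} {d : measure_display} {T : measurableType d}.
Variables (mu : {measure set T -> \bar R}) (W Y : T -> R).

(** Expectation under the density W. Integrability is included so that means combine linearly with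
    real coefficients of any sign. *)
Definition has_mean (g : R -> R) (c : R) : Prop :=
  mu.-integrable setT (fun w => (W w * g (Y w))%:E) /\
  (\int[mu]_w (W w * g (Y w))%:E = c%:E)%E.

Lemma has_mean_ext {g h : R -> R} {c e : R} : has_mean g c -> (forall y, h y = g y) -> e = c ->
  has_mean h e.
Proof. by move=> gc hg ->; have -> : h = g by exact/funext. Qed.

Lemma has_meanD {g h : R -> R} {c e : R} : has_mean g c -> has_mean h e ->
  has_mean (fun y => g y + h y) (c + e).
Proof.
move=> [ig cE] [ih eE]; split.
  apply: eq_integrable (integrableD measurableT ig ih) => // w _ /=.
  by rewrite -EFinD mulrDr.
rewrite EFinD -cE -eE -integralD//.
by apply: eq_integral => w _; rewrite -EFinD mulrDr.
Qed.

Lemma has_meanZ {g : R -> R} {c : R} (a : R) : has_mean g c -> has_mean (fun y => a * g y) (a * c).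
Proof.
move=> [ig cE]; split.
  apply: eq_integrable (integrableZl measurableT a ig) => // w _ /=.
  by rewrite -EFinM mulrCA.
rewrite EFinM -cE -integralZl//.
by apply: eq_integral => w _; rewrite -EFinM mulrCA.
Qed.

Hypothesis W0 : forall w, 0 <= W w.
Hypotheses (mW : measurable_fun setT W) (mY : measurable_fun setT Y).

Lemma measurable_weighted {f : R -> R} : measurable_fun setT f ->
  measurable_fun setT (fun w => (W w * f (Y w))%:E).
Proof.
by move=> mf; apply/measurable_EFinP/measurable_funM => //; exact: measurableT_comp.
Qed.

Lemma has_mean_ub {f g : R -> R} {c : R} : measurable_fun setT f -> (forall y, 0 <= f y) ->
  (forall y, f y <= g y) -> has_mean g c ->
  (\int[mu]_w (W w * f (Y w))%:E <= c%:E)%E.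
Proof.
move=> mf f0 fg [ig <-]; apply: ge0_le_integral => //.
- by move=> w _; rewrite lee_fin mulr_ge0.
- exact: measurable_weighted.
- exact: measurable_int ig.
- by move=> w _; rewrite lee_fin ler_wpM2l.
Qed.

(** The minorant g may be negative and f need not be integrable, so the comparison goes through the
    positive part of g. *)
Lemma has_mean_lb {f g : R -> R} {c : R} : measurable_fun setT f -> (forall y, 0 <= f y) ->
  (forall y, g y <= f y) -> has_mean g c ->
  (c%:E <= \int[mu]_w (W w * f (Y w))%:E)%E.
Proof.
move=> mf f0 gf [ig <-].
have mg : measurable_fun setT (fun w => (W w * g (Y w))%:E) by exact: measurable_int ig.
apply: (@le_trans _ _ (\int[mu]_w ((fun w => (W w * g (Y w))%:E)^\+ w))%E).
  by rewrite [leLHS]integralE geeDl// oppe_le0 integral_ge0.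
apply: ge0_le_integral => //.
- exact: measurable_funepos.
- exact: measurable_weighted.
- move=> w _; rewrite funeposE ge_max !lee_fin mulr_ge0// andbT.
  by rewrite ler_wpM2l.
Qed.

Lemma has_mean_le {g h : R -> R} {c e : R} : (forall y, g y <= h y) ->
  has_mean g c -> has_mean h e -> c <= e.
Proof.
move=> gh [ig cE] [ih eE]; rewrite -lee_fin -cE -eE.
apply: le_integral => // w _; by rewrite lee_fin ler_wpM2l.
Qed.

Lemma has_mean_dom {g h : R -> R} {c : R} : measurable_fun setT h ->
  (forall y, `|h y| <= g y) -> has_mean g c -> exists e, has_mean h e.
Proof.
move=> mh hg [ig cE].
have ih : mu.-integrable setT (fun w => (W w * h (Y w))%:E).
  apply: le_integrable ig => //; first exact: measurable_weighted.
  move=> w _; rewrite lee_fin !normrM ler_wpM2l//.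
  by rewrite (le_trans (hg _))// ler_norm.
exists (fine (\int[mu]_w (W w * h (Y w))%:E)%E); split => //.
by rewrite fineK//; exact: integrable_fin_num.
Qed.

(* V dominates, by the margin s, its mean after one step killed outside [0, L]. *)
Record killed_superharmonic (L : R) (V s : R -> R) : Prop :=
  KilledSuperharmonic {
    ks_measurable : measurable_fun setT V;
    ks_ge0 : forall y, 0 <= V y;
    ks_out : forall y : R, ~ (0 <= y <= L) -> V y = 0;
    ks_mean : forall y : R, 0 <= y <= L ->
      (\int[mu]_w (W w * V (y + Y w))%:E <= (V y - s y)%:E)%E }.

End weighted_mean.

Arguments ks_measurable {R d T mu W Y L V s}.
Arguments ks_ge0 {R d T mu W Y L V s}.
Arguments ks_mean {R d T mu W Y L V s}.

Section barrier.
Context {R : realType} {d : measure_display} {T : measurableType d}.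
Variables (mu : {measure set T -> \bar R}) (W Y : T -> R).
Hypothesis W0 : forall w, 0 <= W w.
Hypotheses (mW : measurable_fun setT W) (mY : measurable_fun setT Y).
Variables (th m1 n1 m2 n2 : R).
Hypotheses (th0 : 0 < th) (th1 : th <= 1).
Hypotheses (h1 : has_mean mu W Y (fun=> 1) 1) (hY : has_mean mu W Y id 0).
Hypotheses (hm1 : has_mean mu W Y (fun y => expR (th * y)) m1)
  (hn1 : has_mean mu W Y (fun y => expR (- (th * y))) n1)
  (hm2 : has_mean mu W Y (fun y => expR (th * y) ^+ 2) m2)
  (hn2 : has_mean mu W Y (fun y => expR (- (th * y)) ^+ 2) n2).
Hypotheses (m1_gt1 : 1 < m1) (n1_gt1 : 1 < n1).

Let has_mean_comb a0 a1 a2 a3 a4 a5 :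
  has_mean mu W Y (fun y => a0 * 1 + a1 * y + a2 * expR (th * y) +
    a3 * expR (- (th * y)) + a4 * expR (th * y) ^+ 2 + a5 * expR (- (th * y)) ^+ 2)
  (a0 + a2 * m1 + a3 * n1 + a4 * m2 + a5 * n2).
Proof.
have := has_meanD mu W Y (has_meanD mu W Y (has_meanD mu W Y (has_meanD mu W Y
  (has_meanD mu W Y (has_meanZ mu W Y a0 h1) (has_meanZ mu W Y a1 hY)) (has_meanZ mu W Y a2 hm1))
  (has_meanZ mu W Y a3 hn1)) (has_meanZ mu W Y a4 hm2)) (has_meanZ mu W Y a5 hn2).
by move=> /has_mean_ext; apply => //; rewrite mulr1 mulr0 addr0.
Qed.

(** Iterating [ks_mean] shows what V is: a bound on the expected sum of e^{- th S} along the walk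
    until it leaves [0, L]. Such a sum is collected near 0, and a walk from y comes near 0 before
    passing L with probability of order (L - y + 1) / L. *)
Lemma barrier_superharmonic : exists C : R, 0 < C /\
  forall L, 1 <= L -> exists V : R -> R,
  killed_superharmonic mu W Y L V (fun x => expR (- (th * x))) /\
  forall y : R, 0 <= y <= L -> V y <= C * (L - y + 1) / L.
Proof.
have m20 : 0 <= m2 by apply: (has_mean_le mu W Y W0 _ _ hm2 (g := fun=> 0 * 1));
  [move=> y; rewrite mul0r; exact: sqr_ge0|have := has_meanZ mu W Y 0 h1; rewrite mul0r].
have n20 : 0 <= n2 by apply: (has_mean_le mu W Y W0 _ _ hn2 (g := fun=> 0 * 1));
  [move=> y; rewrite mul0r; exact: sqr_ge0|have := has_meanZ mu W Y 0 h1; rewrite mul0r].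
(* The exponential at 0 gains B (n1 - 1) = 2 times e^{- th x}: one unit is the required margin, the
   other pays for jumps below 0. *)
pose B := 2 / (n1 - 1).
have B0 : 0 < B by rewrite divr_gt0// subr_gt0.
have BE : B * (n1 - 1) = 2 by rewrite /B divfK// gt_eqF// subr_gt0.
(* The first summand keeps V nonnegative ([Bb]), the second gives [k1n]. *)
pose A := B / th + B ^+ 2 * n2.
have A1 : B / th <= A by rewrite lerDl mulr_ge0// sqr_ge0.
have A0 : 0 < A by apply: lt_le_trans A1; rewrite divr_gt0.
have A2 : B ^+ 2 * n2 <= A by rewrite lerDr divr_ge0// ltW.
(* With this value A - B t + k1 t^2 has negative discriminant, which settles [Vdom] below 0. *)
pose k1 := B ^+ 2 / A.
have k1E : k1 * A = B ^+ 2 by rewrite /k1 divfK// gt_eqF.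
have k10 : 0 <= k1 by rewrite divr_ge0 ?sqr_ge0// ltW.
have k1n : k1 * n2 <= 1.
  by rewrite /k1 mulrAC ler_pdivrMr// mul1r.
(* Above L the quadratic is (a - 1) - (1 + 1/th) t + k t^2; k makes its discriminant negative, and a
   is large enough for k m2 to stay below the gain m1 - 1. *)
pose q := (1 + th^-1) ^+ 2.
have q0 : 0 <= q by exact: sqr_ge0.
pose a := 2 + q * m2 / (m1 - 1).
have a2 : 2 <= a.
  by rewrite lerDl; apply: divr_ge0; [exact: mulr_ge0|rewrite subr_ge0 ltW].
have a10 : 0 < a - 1 by lra.
pose k := q / (a - 1).
have kE : k * (a - 1) = q by rewrite /k divfK// gt_eqF.
have k0 : 0 <= k by rewrite divr_ge0// ltW.
have km : k * m2 <= m1 - 1.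
  have : q * m2 / (m1 - 1) <= a - 1 by rewrite /a; lra.
  rewrite ler_pdivrMr ?subr_gt0// => h.
  by rewrite /k mulrAC ler_pdivrMr// (mulrC (m1 - 1)).
exists (A * a); split; first by rewrite mulr_gt0//; lra.
move=> L L1; have L0 : 0 < L by lra.
pose AL := A / L.
have AL0 : 0 < AL by rewrite divr_gt0.
have ALE : AL * L = A by rewrite /AL divfK// gt_eqF.
(* The affine part is harmonic.  Each exponential has a strict gain at its own end
   of [0, L], which pays for the jumps out of [0, L] from there: those cost at most
   a small multiple of the squared exponential (see Vdom). *)
pose V0 z := AL * (L - z + a - expR (th * z) * expR (- (th * L))) - B * expR (- (th * z)).
have e1 (x : R) : 0 <= x -> expR (- (th * x)) * (1 + th * x) <= 1.
  move=> x0; rewrite expRN mulrC ler_pdivrMr ?expR_gt0// mul1r expR_ge1Dx//.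
have e2 z : z <= L -> expR (th * z) * expR (- (th * L)) <= 1.
  by move=> zL; rewrite -expRD -mulrBr -[leRHS]expR0 ler_expR mulr_ge0_le0 ?subr_le0// ltW.
(* The exponential is at most 1 / (1 + th x), and L <= (L - x + 1) (1 + x) on [0, L]. *)
have Bb (x : R) : 0 <= x -> x <= L -> B * expR (- (th * x)) <= AL * (L - x + 1).
  move=> x0 xL; have := e1 x x0; set E := expR _ => hE.
  have E0 : 0 <= E by exact: expR_ge0.
  have h3 : E * th * (1 + x) <= 1.
    apply: (le_trans _ hE); have : 0 <= E * (1 - th) by rewrite mulr_ge0// subr_ge0.
    by nra.
  have h4 : E * th * L <= L - x + 1.
    have h5 : L <= (L - x + 1) * (1 + x) by nra.
    have h6 : 0 <= L - x + 1 by lra.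
    apply: (@le_trans _ _ (E * th * ((L - x + 1) * (1 + x)))).
      by rewrite ler_wpM2l// mulr_ge0// ltW.
    by rewrite mulrCA -[leRHS]mulr1 ler_wpM2l// mulrAC.
  have h7 : B * E * L <= A * (L - x + 1).
    apply: (@le_trans _ _ (B / th * (L - x + 1))); last first.
      by rewrite ler_wpM2r//; lra.
    have -> : B * E * L = B / th * (E * th * L) by field; rewrite gt_eqF.
    by rewrite ler_wpM2l// divr_ge0// ltW.
  by rewrite /AL [leRHS]mulrAC ler_pdivlMr.
have V0in (z : R) : 0 <= z <= L -> 0 <= V0 z <= A * a * (L - z + 1) / L.
  move=> /andP[z0 zL]; have := Bb z z0 zL; have := e2 z zL.
  have := expR_ge0 (- (th * z)); rewrite /V0.
  have E20 : 0 <= expR (th * z) * expR (- (th * L)) by rewrite mulr_ge0 ?expR_ge0.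
  set E2 := expR (th * z) * _ in E20 *; set E1 := expR _ => E10 hE2 hE1.
  have -> : A * a * (L - z + 1) / L = AL * (a * (L - z + 1)) by rewrite /AL; ring.
  have h1' : 0 <= AL * (1 - E2) by rewrite mulr_ge0//; [exact: ltW|lra].
  apply/andP; split.
    have : 0 <= AL * (a - 2) by rewrite mulr_ge0//; [exact: ltW|lra].
    nra.
  apply: (@le_trans _ _ (AL * (L - z + a))).
    have : 0 <= AL * E2 by rewrite mulr_ge0// ltW.
    have : 0 <= B * E1 by rewrite mulr_ge0// ltW.
    nra.
  rewrite ler_wpM2l//; first exact: ltW.
  nra.
pose V z := \1_`[0, L]%classic z * V0 z.
have VE (z : R) : 0 <= z <= L -> V z = V0 z.
  by move=> zL; rewrite /V indicE mem_set ?mul1r//= in_itv.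
have VN (z : R) : ~ (0 <= z <= L) -> V z = 0.
  by move=> zL; rewrite /V indicE memNset ?mul0r//= in_itv.
(* A majorant made of functions with known means: outside [0, L], where V is 0 and V0 may be
   negative, the square belonging to that side compensates. *)
have Vdom z : V z <= V0 z + k1 * expR (- (th * z)) ^+ 2 +
    AL * k * (expR (th * z) * expR (- (th * L))) ^+ 2.
  have E20 : 0 <= expR (th * z) * expR (- (th * L)) by rewrite mulr_ge0 ?expR_ge0.
  have E10 := expR_ge0 (- (th * z)).
  have p1 : 0 <= k1 * expR (- (th * z)) ^+ 2 by rewrite mulr_ge0// sqr_ge0.
  have p2 : 0 <= AL * k * (expR (th * z) * expR (- (th * L))) ^+ 2.
    by apply: mulr_ge0; [rewrite mulr_ge0// ltW|exact: sqr_ge0].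
  have [zI|zI] := boolP (0 <= z <= L); first by rewrite VE//; lra.
  rewrite VN; last exact/negP.
  move: zI; rewrite negb_and -!ltNge => /orP[z0|zL].
    have hE2 := e2 z (le_trans (ltW z0) (ltW L0)).
    move: p1 p2 E10 E20 hE2; rewrite /V0.
    set E2 := expR (th * z) * _; set E1 := expR (- (th * z)) => p1 p2 E10 E20 hE2.
    have g1 : A <= AL * (L - z + a - E2).
      by rewrite -{1}ALE ler_wpM2l// ?ltW//; lra.
    have g2 : 0 <= A - B * E1 + k1 * E1 ^+ 2.
      rewrite -(pmulr_rge0 _ A0).
      have -> : A * (A - B * E1 + k1 * E1 ^+ 2) =
        A ^+ 2 - A * B * E1 + (k1 * A) * E1 ^+ 2 by ring.
      by rewrite k1E; have := sqr_ge0 (A - B * E1 / 2); have := sqr_ge0 (B * E1); nra.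
    lra.
  have hE1 : B * expR (- (th * z)) <= AL.
    have := Bb L (ltW L0) (lexx _); rewrite subrr add0r mulr1; apply: le_trans.
    by rewrite ler_wpM2l ?ltW// ltr_expR ltrN2 ltr_pM2l.
  have hz : th * (z - L) <= expR (th * z) * expR (- (th * L)).
    rewrite -expRD -mulrBr; apply: le_trans (expR_ge1Dx _); lra.
  move: p1 p2 E10 E20 hE1 hz; rewrite /V0.
  set E2 := expR (th * z) * _; set E1 := expR (- (th * z)) => p1 p2 E10 E20 hE1 hz.
  have hz' : z - L <= E2 / th by rewrite ler_pdivlMr// mulrC.
  have g : 0 <= (a - 1) - (1 + th^-1) * E2 + k * E2 ^+ 2.
    rewrite -(pmulr_rge0 _ a10).
    have -> : (a - 1) * ((a - 1) - (1 + th^-1) * E2 + k * E2 ^+ 2) =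
      (a - 1) ^+ 2 - (a - 1) * ((1 + th^-1) * E2) + (k * (a - 1)) * E2 ^+ 2 by ring.
    rewrite kE /q -exprMn.
    by have := sqr_ge0 ((a - 1) - (1 + th^-1) * E2 / 2); have := sqr_ge0 ((1 + th^-1) * E2); nra.
  have g' : 0 <= AL * (L - z + a - E2 - 1 + k * E2 ^+ 2).
    rewrite mulr_ge0//; first exact: ltW.
    apply: le_trans g _; lra.
  lra.
have mV : measurable_fun setT V.
  apply: measurable_funM; [exact: measurable_indic|measurable_expr].
have V_ge0 y : 0 <= V y.
  have [yI|/negP yI] := boolP (0 <= y <= L); last by rewrite VN.
  by rewrite VE//; have /andP[] := V0in y yI.
exists V; split; last first.
  by move=> y yI; rewrite VE//; have /andP[] := V0in y yI.
split => //.
- move=> x /andP[x0 xL].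
  rewrite VE ?x0//.
  pose E1 := expR (- (th * x)); pose E2 := expR (th * x) * expR (- (th * L)).
  have E20 : 0 <= E2 by rewrite mulr_ge0 ?expR_ge0.
  have E10 : 0 <= E1 := expR_ge0 _.
  have E11 : E1 <= 1 by rewrite -expR0 ler_expR oppr_le0 mulr_ge0// ltW.
  have E21 : E2 <= 1 by exact: e2.
  have := has_mean_comb (AL * (L - x + a)) (- AL) (- AL * E2) (- B * E1)
    (AL * k * E2 ^+ 2) (k1 * E1 ^+ 2).
  move=> H; apply: (le_trans (has_mean_ub mu W Y W0 mW mY _ _ _ H (f := fun y => V (x + y)))).
  + exact: measurableT_comp mV (measurable_funD (measurable_cst _) (@measurable_id _ _ _)).
  + by move=> y; exact: V_ge0.
  + move=> y; apply: le_trans (Vdom (x + y)) _; rewrite /V0.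
    have -> : expR (th * (x + y)) = expR (th * x) * expR (th * y) by rewrite -expRD mulrDr.
    have -> : expR (- (th * (x + y))) = E1 * expR (- (th * y)).
      by rewrite -expRD mulrDr opprD.
    by rewrite /E2; lra.
  rewrite lee_fin /V0 -/E1 -/E2.
  have km0 : 0 <= k * m2 by exact: mulr_ge0.
  have g1 : 0 <= AL * (E2 * ((m1 - 1) - k * m2 * E2)).
    rewrite mulr_ge0//; first exact: ltW.
    by rewrite mulr_ge0// subr_ge0 (le_trans _ km)// ler_piMr.
  have g2 : 0 <= E1 * (1 - k1 * n2 * E1).
    by rewrite mulr_ge0// subr_ge0 (le_trans _ k1n)// ler_piMr// mulr_ge0.
  have g3 : B * E1 * (n1 - 1) = 2 * E1 by rewrite mulrAC BE.
  nra.
Qed.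

End barrier.

(** * The exponential change of measure *)

Lemma expR_le_quadratic {R : realType} (t : R) :
  expR t <= 1 + t + t ^+ 2 * expR `|t|.
Proof.
have h (u : R) : expR u - 1 <= u * expR u.
  have := expR_ge1Dx (- u); rewrite expRN => h.
  have := expR_gt0 u; set e := expR u in h * => e0.
  have h' : (1 - u) * e <= 1 by rewrite -ler_pdivlMr// div1r.
  lra.
have h2 : t * (expR t - 1) <= t ^+ 2 * expR `|t|.
  have [t0|t0] := leP 0 t.
    by rewrite ger0_norm// expr2 -mulrA ler_wpM2l.
  rewrite ltr0_norm// expr2 -mulrA.
  have h3 : 1 - expR t <= - t by have := expR_ge1Dx t; lra.
  have h4 : 1 <= expR (- t) by rewrite -[leLHS]expR0 ler_expR oppr_ge0 ltW.
  nra.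
have := h t; lra.
Qed.

(** Controls the remainder in [expR_le_quadratic]: s^2 times a function of t that does not depend on
    s and has a finite tilted mean when 2u lies in the domain. *)
Lemma sqr_expR_bound {R : realType} (s t u : R) : 0 < u -> `|s| <= u ->
  (s * t) ^+ 2 * expR `|s * t| <=
  s ^+ 2 * (u^-1 ^+ 2 * 4 * (expR (2 * u * t) + expR (- (2 * u * t)))).
Proof.
move=> u0 su.
rewrite exprMn -[leLHS]mulrA ler_wpM2l ?sqr_ge0//.
have a1 : expR `|s * t| <= expR (u * `|t|) by rewrite ler_expR normrM ler_wpM2r.
have a2 : t ^+ 2 <= u^-1 ^+ 2 * 4 * expR (u * `|t|).
  have := expR_ge1Dx (u * `|t| / 2) => h.
  have h0 : 0 <= u * `|t| / 2 by rewrite divr_ge0// mulr_ge0// ltW.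
  have -> : expR (u * `|t|) = expR (u * `|t| / 2) ^+ 2.
    by rewrite -expRM_natl -mulr_natr; congr expR; field.
  have -> : t ^+ 2 = u^-1 ^+ 2 * 4 * (u * `|t| / 2) ^+ 2.
    by rewrite -(real_normK (num_real t)); field; rewrite gt_eqF.
  apply: ler_wpM2l; first by rewrite mulr_ge0// sqr_ge0.
  by rewrite lerXn2r// ?nnegrE ?expR_ge0//; lra.
apply: (@le_trans _ _ (u^-1 ^+ 2 * 4 * expR (u * `|t|) * expR (u * `|t|))).
  by rewrite ler_pM ?sqr_ge0 ?expR_ge0.
rewrite -[leLHS]mulrA; apply: ler_wpM2l; first by apply: mulr_ge0; rewrite ?sqr_ge0.
rewrite -expRD.
have [t0|t0] := leP 0 t.
  rewrite ger0_norm// (_ : u * t + u * t = 2 * u * t); last by ring.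
  by rewrite lerDl expR_ge0.
rewrite ltr0_norm// (_ : u * - t + u * - t = - (2 * u * t)); last by ring.
by rewrite lerDr expR_ge0.
Qed.

Lemma norm_le_expR {R : realType} (u y : R) : 0 < u ->
  `|y| <= u^-1 * (expR (u * y) + expR (- u * y)).
Proof.
move=> u0.
rewrite ler_pdivlMl// -{1}(gtr0_norm u0) -normrM.
have [t0|t0] := leP 0 (u * y).
  rewrite ger0_norm// (le_trans _ (_ : expR (u * y) <= _))//.
    by have := expR_ge1Dx (u * y); lra.
  by rewrite lerDl expR_ge0.
rewrite ltr0_norm// (le_trans _ (_ : expR (- u * y) <= _))//.
  by have := expR_ge1Dx (- u * y); lra.
by rewrite lerDr expR_ge0.
Qed.

Section tilt.
Context {R : realType} {b : nat} {d0 : measure_display} {T0 : measurableType d0}.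
Context {P0 : probability T0 R}.
Variable X : {RV P0 >-> R}.
Hypothesis hX : ~ lattice_distribution X.
Hypothesis hb : (2 <= b)%N.
Variable rho : R.
Hypothesis rho_int : interior [set t : R | ('M_P0 X t < +oo)%E] rho.
Hypothesis rho_min : forall t : R, ('M_P0 X rho <= 'M_P0 X t)%E.
Hypothesis crit : 'M_P0 X rho = ((b%:R)^-1)%:E.

(** Density of the tilted step law with respect to P0; the factor b stands for the sum over the
    children, and criticality makes the total mass 1. *)
Definition tilt (w : T0) : R := b%:R * expR (rho * X w).

Local Notation tmean := (has_mean P0 tilt X).

Lemma tilt_ge0 w : 0 <= tilt w.
Proof. by rewrite mulr_ge0// expR_ge0. Qed.

Lemma measurable_tilt : measurable_fun setT tilt.
Proof.
by measurable_expr; exact: measurable_funPT.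
Qed.

Let b0 : 0 < b%:R :> R.
Proof. by rewrite ltr0n (leq_trans _ hb). Qed.

Let mgfE t : ('M_P0 X t = \int[P0]_w (expR (t * X w))%:E)%E.
Proof.
rewrite /mmt_gen_fun unlock; apply: eq_integral => w _ /=.
by rewrite mulrC.
Qed.

Lemma tilt_mgf s (m : R) : 'M_P0 X (rho + s) = m%:E ->
  tmean (fun y => expR (s * y)) (b%:R * m).
Proof.
rewrite mgfE => hm.
have me : measurable_fun setT (fun w => (expR ((rho + s) * X w))%:E).
  by apply/measurable_EFinP; measurable_expr; exact: measurable_funPT.
have i1 : P0.-integrable setT (fun w => (expR ((rho + s) * X w))%:E).
  apply/integrableP; split => //.
  under eq_integral do rewrite gee0_abs ?lee_fin ?expR_ge0//.
  by rewrite hm ltry.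
have E w : tilt w * expR (s * X w) = b%:R * expR ((rho + s) * X w).
  by rewrite /tilt -mulrA -expRD mulrDl.
split.
  apply: eq_integrable (integrableZl measurableT b%:R i1) => // w _ /=.
  by rewrite E EFinM.
under eq_integral do rewrite E EFinM.
by rewrite integralZl// hm.
Qed.

Lemma tilt_mean1 : tmean (fun=> 1) 1.
Proof.
have := tilt_mgf 0 b%:R^-1; rewrite addr0 crit => /(_ erefl).
move=> /has_mean_ext; apply => [y|]; first by rewrite mul0r expR0.
by rewrite divff// gt_eqF.
Qed.

(** The exponent - rho undoes the tilt and leaves b times the mass of P0. *)
Lemma tilt_mean_rho : tmean (fun y => expR (- (rho * y))) b%:R.
Proof.
have := tilt_mgf (- rho) 1; rewrite subrr mgfE.
under eq_integral do rewrite mul0r expR0.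
rewrite integral_cst//= probability_setT mule1 => /(_ erefl).
by move=> /has_mean_ext; apply => [y|]; rewrite ?mulNr ?mulr1.
Qed.

(** The tilted mean of e^{sX} is b phi(rho + s): finite near s = 0 since rho is interior, and at
    least b phi(rho) = 1 since rho is a minimum. *)
Lemma tilt_mean_exp : exists u : R, 0 < u /\
  forall s : R, `|s| <= u -> exists m, 1 <= m /\ tmean (fun y => expR (s * y)) m.
Proof.
have [e /= e0 he] := rho_int.
exists (e / 2); split; first by rewrite divr_gt0.
move=> s se.
have hs : ('M_P0 X (rho + s) < +oo)%E.
  apply: he => /=; rewrite opprD addNKr normrN (le_lt_trans se)// ltr_pdivrMr//.
  by rewrite ltr_pMr// ltr1n.
have m0 : (0 <= 'M_P0 X (rho + s))%E.
  by rewrite mgfE; apply: integral_ge0 => w _; rewrite lee_fin expR_ge0.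
have mE : 'M_P0 X (rho + s) = (fine ('M_P0 X (rho + s)))%:E.
  by rewrite fineK// ge0_fin_numE.
exists (b%:R * fine ('M_P0 X (rho + s))%E); split; last exact: tilt_mgf.
rewrite -ler_pdivrMl// mulr1 -lee_fin -mE -crit; exact: rho_min.
Qed.

(** A zero mean would force g(X) = 0, hence X = 0, almost surely, and the law of X would be carried
    by 0 + 1 Z. *)
Lemma tilt_mean_gt0 {g : R -> R} {c : R} : measurable_fun setT g ->
  (forall y, 0 <= g y) ->
  (forall y, g y = 0 -> y = 0) -> tmean g c -> 0 < c.
Proof.
move=> mg g0 gN [ig cE].
have c0 : 0 <= c.
  rewrite -lee_fin -cE; apply: integral_ge0 => w _.
  by rewrite lee_fin mulr_ge0// tilt_ge0.
rewrite lt_neqAle c0 andbT; apply/eqP => c00; apply: hX.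
have : ae_eq P0 setT (fun w => (tilt w * g (X w))%:E) (cst 0%E).
  apply/ae_eq_integral_abs => //; first exact: measurable_int ig.
  under eq_integral do rewrite gee0_abs ?lee_fin ?mulr_ge0 ?tilt_ge0//.
  by rewrite cE -c00.
move=> [N [mN PN hN]].
exists 0, 1; split => //.
pose f (k : int) : R := 0 + k%:~R * 1.
have mS : measurable (range f).
  have -> : range f =
      \bigcup_n [set f (Posz n)] `|` \bigcup_n [set f (Negz n)].
    apply/seteqP; split => [_ [[n|n] _ <-]|_ [[n _ ->]|[n _ ->]]].
    - by left; exists n.
    - by right; exists n.
    - by exists (Posz n).
    - by exists (Negz n).
  by apply: measurableU; apply: bigcupT_measurable.
apply/eqP; rewrite eq_le probability_le1//=.
rewrite /distribution /= /pushforward.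
have mXS := measurable_funPTI X mS.
have -> : (1 = P0 (~` N))%E.
  by rewrite probability_setC// PN sube0.
apply: le_measure; [exact/mem_set/measurableC|exact/mem_set|].
move=> w /= nNw; exists 0 => //; rewrite /f mul0r add0r; apply/esym/gN.
apply: contrapT => gX; apply: nNw; apply: hN => /= /(_ I) /eqP.
by rewrite eqe mulf_eq0 /tilt mulf_eq0 (gt_eqF b0) (gt_eqF (expR_gt0 _))/= => /eqP.
Qed.

(** This is phi'(rho) = 0, obtained from a quadratic bound instead of differentiating under the
    integral. *)
Lemma tilt_mean_id : tmean id 0.
Proof.
have [u [u0 hu]] := tilt_mean_exp.
have [mp [_ hmp]] := hu u ltac:(by rewrite gtr0_norm).
have [mn [_ hmn]] := hu (- u) ltac:(by rewrite normrN gtr0_norm).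
pose v := u / 2.
have v0 : 0 < v by rewrite divr_gt0.
have v2 : 2 * v = u by rewrite /v; field.
pose K y := v^-1 ^+ 2 * 4 * (expR (u * y) + expR (- (u * y))).
have hK : tmean K (v^-1 ^+ 2 * 4 * (mp + mn)).
  apply: has_meanZ; apply: has_meanD => //.
  by apply: has_mean_ext hmn _ erefl => y; rewrite mulNr.
set k := (X in tmean K X) in hK.
have [c hc] : exists c, tmean id c.
  have hD := has_meanZ P0 tilt X u^-1 (has_meanD P0 tilt X hmp hmn).
  have mX : measurable_fun setT (X : T0 -> R) by exact: measurable_funPT.
  apply: (has_mean_dom P0 tilt X measurable_tilt mX (@measurable_id _ R setT) _ hD) => y.
  exact: norm_le_expR.
(* 1 <= E~[e^{sX}] <= 1 + s c + s^2 k for small s of either sign forces c = 0. *)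
have key s : `|s| <= v -> 0 <= s * c + s ^+ 2 * k.
  move=> sv.
  have [m [m1 hm]] := hu s ltac:(by rewrite (le_trans sv)//; lra).
  have := has_mean_le P0 tilt X tilt_ge0 _ hm (has_meanD _ _ _
    (has_meanD _ _ _ tilt_mean1 (has_meanZ _ _ _ s hc)) (has_meanZ _ _ _ (s ^+ 2) hK)).
  move=> /(_ _)/wrap[|h]; last by lra.
  move=> y; apply: le_trans (expR_le_quadratic _) _; rewrite lerD2l.
  by have := sqr_expR_bound s y v v0 sv; rewrite v2.
suff -> : 0 = c by [].
apply/eqP/negPn/negP => c0.
have k0 : 0 <= k.
  by have := key v ltac:(by rewrite gtr0_norm); have := key (- v) ltac:(by rewrite normrN gtr0_norm); nra.
(* Small enough for the linear term |s c| to exceed s^2 k, so that one of the signs of s contradicts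
   [key]. *)
pose s := Num.min v (`|c| / (2 * (k + 1))).
have s0 : 0 < s by rewrite lt_min v0 divr_gt0// ?normr_gt0 1?eq_sym// mulr_gt0//; lra.
have sv : `|s| <= v by rewrite gtr0_norm// ge_min lexx.
have sk : s * k < `|c|.
  have : s <= `|c| / (2 * (k + 1)) by rewrite ge_min lexx orbT.
  rewrite ler_pdivlMr; last by rewrite mulr_gt0//; lra.
  nra.
have := key s sv; have := key (- s) ltac:(by rewrite normrN).
have [cp|cn] := leP 0 c.
  by rewrite ger0_norm// in sk; nra.
by rewrite ltr0_norm// in sk; nra.
Qed.

(** Strict convexity: e^t - 1 - t vanishes only at t = 0, and its tilted mean is m - 1 because the
    walk is centred. *)
Lemma tilt_mean_gt1 (s m : R) : s != 0 -> tmean (fun y => expR (s * y)) m -> 1 < m.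
Proof.
move=> s0 hm; rewrite -subr_gt0.
have := has_meanD _ _ _ hm (has_meanD _ _ _ (has_meanZ _ _ _ (-1) tilt_mean1)
  (has_meanZ _ _ _ (- s) tilt_mean_id)).
have -> : m + (-1 * 1 + - s * 0) = m - 1 by ring.
apply: tilt_mean_gt0.
- by measurable_expr.
- by move=> y; have := expR_ge1Dx (s * y); rewrite /=; lra.
- move=> y /= h; apply/eqP; apply: contrapT => /negP y0.
  by have := @expR_gt1Dx _ (s * y) (mulf_neq0 s0 y0); lra.
Qed.

(** As X is centred, the mean of its positive part is half the mean of |X|. *)
Lemma tilt_mean_pos : exists c, 0 < c /\ tmean (fun y => Num.max y 0) c.
Proof.
have [u [u0 hu]] := tilt_mean_exp.
have [mp [_ hmp]] := hu u ltac:(by rewrite gtr0_norm).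
have [mn [_ hmn]] := hu (- u) ltac:(by rewrite normrN gtr0_norm).
have [c hc] : exists c, tmean Num.norm c.
  have hD := has_meanZ P0 tilt X u^-1 (has_meanD P0 tilt X hmp hmn).
  have mX : measurable_fun setT (X : T0 -> R) by exact: measurable_funPT.
  apply: (has_mean_dom P0 tilt X measurable_tilt mX (@normr_measurable R setT) _ hD) => y.
  by rewrite normr_id; exact: norm_le_expR.
have c0 : 0 < c.
  apply: tilt_mean_gt0 hc => // y /eqP.
  by rewrite normr_eq0 => /eqP.
exists (2^-1 * (0 + c)); split; first by rewrite mulr_gt0//; lra.
apply: has_mean_ext (has_meanZ _ _ _ _ (has_meanD _ _ _ tilt_mean_id hc)) _ erefl => y.
have [y0|y0] := leP 0 y.
  by rewrite ger0_norm//; field.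
by rewrite ltr0_norm//; field.
Qed.

End tilt.

(** The barrier with margin concentrated near L is the one near 0 for the reversed step - X, read at
    L - y. *)
Lemma tilt_barriers {R : realType} {b : nat} {d0 : measure_display}
    {T0 : measurableType d0} {P0 : probability T0 R} (X : {RV P0 >-> R})
    (hX : ~ lattice_distribution X) (hb : (2 <= b)%N) (rho : R)
    (rho_gt0 : 0 < rho)
    (rho_int : interior [set t : R | ('M_P0 X t < +oo)%E] rho)
    (rho_min : forall t : R, ('M_P0 X rho <= 'M_P0 X t)%E)
    (crit : 'M_P0 X rho = ((b%:R)^-1)%:E) :
  exists th m1 m2 C : R,
  [/\ 0 < th <= 1, 2 * th <= rho, 1 < m1, 0 < C &
   [/\ has_mean P0 (@tilt R b _ _ _ X rho) X (fun y => expR (th * y)) m1,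
       has_mean P0 (@tilt R b _ _ _ X rho) X (fun y => expR (th * y) ^+ 2) m2,
       (forall L : R, 1 <= L -> exists V,
         killed_superharmonic P0 (@tilt R b _ _ _ X rho) X L V (fun x => expR (- (th * x))) /\
         forall y : R, 0 <= y <= L -> V y <= C * (L - y + 1) / L) &
       (forall L : R, 1 <= L -> exists V,
         killed_superharmonic P0 (@tilt R b _ _ _ X rho) X L V (fun x => expR (- (th * (L - x)))) /\
         forall y : R, 0 <= y <= L -> V y <= C * (y + 1) / L)]].
Proof.
have [u [u0 hu]] := tilt_mean_exp X hb rho rho_int rho_min crit.
(* th <= u / 2 gives the squared exponentials a mean; 2 th <= rho lets e^{rho y} absorb e^{- th y}
   in the first moment and leaves room for a polynomial factor in the second. *)
pose th := Num.min (Num.min 1 (rho / 2)) (u / 2).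
have th0 : 0 < th by rewrite !lt_min ltr01 !divr_gt0.
have th1 : th <= 1 by rewrite !ge_min lexx.
have thr : 2 * th <= rho.
  by rewrite mulrC -ler_pdivlMr// !ge_min lexx orbT.
have thu : 2 * th <= u by rewrite mulrC -ler_pdivlMr// !ge_min lexx orbT.
have [m1 [_ hm1]] := hu th ltac:(by rewrite gtr0_norm//; lra).
have [n1 [_ hn1]] := hu (- th) ltac:(by rewrite normrN gtr0_norm//; lra).
have [m2 [_ hm2]] := hu (2 * th) ltac:(by rewrite gtr0_norm//; lra).
have [n2 [_ hn2]] := hu (- (2 * th)) ltac:(by rewrite normrN gtr0_norm//; lra).
have m11 : 1 < m1.
  by apply: (tilt_mean_gt1 X hX hb rho rho_int rho_min crit) hm1; rewrite gt_eqF.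
have n11 : 1 < n1.
  by apply: (tilt_mean_gt1 X hX hb rho rho_int rho_min crit) hn1; rewrite oppr_eq0 gt_eqF.
have t1 := tilt_mean1 X hb rho crit.
have tid := tilt_mean_id X hb rho rho_int rho_min crit.
set W := tilt X rho in hm1 hn1 hm2 hn2 t1 tid *.
have W0 := @tilt_ge0 R b _ _ _ X rho.
have mW := @measurable_tilt R b _ _ _ X rho.
have mX : measurable_fun setT X by exact: measurable_funPT.
have hm2' : has_mean P0 W X (fun y => expR (th * y) ^+ 2) m2.
  by apply: has_mean_ext hm2 _ erefl => y; rewrite -expRM_natl mulrA.
have hn1' : has_mean P0 W X (fun y => expR (- (th * y))) n1.
  by apply: has_mean_ext hn1 _ erefl => y; rewrite mulNr.
have hn2' : has_mean P0 W X (fun y => expR (- (th * y)) ^+ 2) n2.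
  by apply: has_mean_ext hn2 _ erefl => y; rewrite -expRM_natl mulrN mulNr mulrA.
have [C1 [C10 H1]] := barrier_superharmonic P0 W X W0 mW mX th m1 n1 m2 n2 th0 th1
  t1 tid hm1 hn1' hm2' hn2' m11 n11.
have mirror (g h : R -> R) c : (forall y, g (- y) = h y) -> has_mean P0 W X h c ->
    has_mean P0 W (\- X) g c.
  move=> gh; rewrite /has_mean.
  have -> // : (fun w => (W w * g ((\- X) w))%:E) = (fun w => (W w * h (X w))%:E).
  by apply/funext => w /=; rewrite gh.
have [C2 [C20 H2]] : exists C : R, 0 < C /\
  forall L, 1 <= L -> exists V : R -> R,
  killed_superharmonic P0 W (\- X) L V (fun x => expR (- (th * x))) /\
  forall y : R, 0 <= y <= L -> V y <= C * (L - y + 1) / L.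
  apply: (barrier_superharmonic P0 W (\- X) W0 mW _ th n1 m1 n2 m2) => //.
  - have := has_meanZ P0 W X (-1) tid; rewrite mulr0 => h; apply: mirror h => y.
    by rewrite mulN1r.
  - by apply: mirror hn1' => y; rewrite mulrN.
  - by apply: mirror hm1 => y; rewrite mulrN opprK.
  - by apply: mirror hn2' => y; rewrite mulrN.
  - by apply: mirror hm2' => y; rewrite mulrN opprK.
exists th, m1, m2, (C1 + C2); split => //.
- by rewrite th0.
- exact: addr_gt0.
split => //.
- move=> L L1; have [V [HV bV]] := H1 L L1; exists V; split => // y /[dup] yI /andP[y0 yL].
  apply: le_trans (bV y yI) _; apply: ler_wpM2r; first by rewrite invr_ge0; lra.
  by apply: ler_wpM2r; lra.
- move=> L L1; have [V [[mV V0 Vout Vmean] bV]] := H2 L L1.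
  have mir (y : R) : (0 <= L - y <= L) = (0 <= y <= L).
    by rewrite subr_ge0 gerBl andbC.
  exists (fun y => V (L - y)); split; last first.
    move=> y yI; have /andP[y0 yL] := yI; rewrite -mir in yI.
    apply: le_trans (bV _ yI) _; apply: ler_wpM2r; first by rewrite invr_ge0; lra.
    have -> : L - (L - y) + 1 = y + 1 by ring.
    by apply: ler_wpM2r; lra.
  split => //.
  + by apply: (measurableT_comp mV); measurable_expr.
  + by move=> y yI; apply: Vout; rewrite mir.
  + move=> y; rewrite -mir => yI; apply: le_trans (Vmean _ yI).
    rewrite le_eqVlt; apply/orP; left; apply/eqP; apply: eq_integral => w _ /=.
    by rewrite opprD addrA.
Qed.

(** * Moment estimates *)

Section estimates.
Context {R : realType} {b : nat}.
Context {d0 : measure_display} {T0 : measurableType d0} {P0 : probability T0 R}.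
Variable X : {RV P0 >-> R}.
Context {d : measure_display} {T : measurableType d} {P : probability T R}.
Variable Xs : vertex b -> {RV P >-> R}.
Hypothesis hXs : iid_with_law [set u : vertex b | u <> tree_root] Xs X.
Variables rho th m1 m2 C : R.
Hypotheses (rho_gt0 : 0 < rho) (th0 : 0 < th) (th1 : th <= 1)
  (th_rho : 2 * th <= rho) (C0 : 0 < C).
Local Notation W := (@tilt R b d0 T0 P0 X rho).
Hypothesis hm1 : has_mean P0 W X (fun y => expR (th * y)) m1.

Local Notation N L k y v w :=
  (branch \1_`[0, L]%classic \1_`[0, L]%classic k y v (fun u => Xs u w)).
Local Notation crossing L k y v w :=
  (branch \1_`]L, +oo[%classic \1_`[0, L]%classic k y v (fun u => Xs u w)).
Local Notation EN L k y v := (\int[P]_w (N L k y v w)%:E)%E.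

Let W0 := @tilt_ge0 R b d0 T0 P0 X rho.
Let mW := @measurable_tilt R b d0 T0 P0 X rho.
Let mX : measurable_fun setT X. Proof. exact: measurable_funPT. Qed.
Let mI (i : interval R) : measurable_fun setT (\1_[set` i] : R -> R).
Proof. exact: measurable_indic. Qed.
Let I0 (A : set R) (y : R) : 0 <= \1_A y :> R. Proof. by rewrite indicE. Qed.

Let indic_in (L y : R) : 0 <= y <= L -> \1_`[0, L]%classic y = 1 :> R.
Proof. by move=> yI; rewrite indicE mem_set//= in_itv. Qed.

Let indic_out (L y : R) : ~ (0 <= y <= L) -> \1_`[0, L]%classic y = 0 :> R.
Proof. by move=> yI; rewrite indicE memNset//= in_itv. Qed.

Let EFin0 (z : R) : 0 <= z -> (0 <= z%:E)%E. Proof. by rewrite lee_fin. Qed.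

Let measurable_shift (f : R -> \bar R) y : measurable_fun setT f ->
  measurable_fun setT (fun w => f (y + X w)).
Proof. by move=> mf; apply: (measurableT_comp mf); exact: measurable_funD. Qed.

Let measurable_expM (V : R -> R) : measurable_fun setT V ->
  measurable_fun setT (fun z => (expR (rho * z) * V z)%:E).
Proof.
by move=> mV; apply/measurable_EFinP/measurable_funM => //; measurable_expr.
Qed.

Let measurable_WM {V : R -> R} y : measurable_fun setT V ->
  measurable_fun setT (fun w => (W w * V (y + X w))%:E).
Proof.
move=> mV; apply: (measurable_weighted W X mW mX (f := fun z => V (y + z))).
by apply: (measurableT_comp mV); exact: measurable_funD.
Qed.

Let WM_ge0 {V : R -> R} y : (forall z, 0 <= V z) ->
  forall w, setT w -> (0 <= (W w * V (y + X w))%:E)%E.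
Proof. by move=> V0 w _; rewrite lee_fin mulr_ge0// W0. Qed.

(** Many-to-one over one generation: e^{rho (y + X)} summed over b children is e^{rho y} times the
    tilt. *)
Lemma sum_children_tilt {V : R -> R} y : measurable_fun setT V ->
  (forall z, 0 <= V z) ->
  (\sum_(i < b) \int[P0]_w (expR (rho * (y + X w)) * V (y + X w))%:E =
   (expR (rho * y))%:E * \int[P0]_w (W w * V (y + X w))%:E)%E.
Proof.
move=> mV V0.
have mU : measurable_fun setT (fun w => (expR (rho * (y + X w)) * V (y + X w))%:E).
  exact: measurable_shift (measurable_expM _ mV).
rewrite -ge0_integral_sum//; last first.
  by move=> i w _; rewrite lee_fin mulr_ge0// expR_ge0.
rewrite -ge0_integralZl ?lee_fin ?expR_ge0//; [|exact: measurable_WM|exact: WM_ge0].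
apply: eq_integral => w _; rewrite sumEFin -EFinM; congr EFin.
rewrite sumr_const card_ord -mulr_natl /tilt mulrDr expRD; ring.
Qed.

Lemma sum_children_le {V : R -> R} {F : 'I_b -> R -> \bar R} {y : R} :
  measurable_fun setT V -> (forall z, 0 <= V z) ->
  (forall i, measurable_fun setT (F i)) -> (forall i z, (0 <= F i z)%E) ->
  (forall i z, (F i z <= (expR (rho * z) * V z)%:E)%E) ->
  (\sum_(i < b) \int[P0]_w F i (y + X w)%R <=
   (expR (rho * y))%:E * \int[P0]_w (W w * V (y + X w))%:E)%E.
Proof.
move=> mV V0 mF F0 FV.
rewrite -sum_children_tilt//; apply: lee_sum => i _.
apply: ge0_le_integral => //.
- exact: measurable_shift.
- exact: measurable_shift (measurable_expM _ mV).
Qed.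

Lemma sum_children_ub {L : R} {V s : R -> R} {F : 'I_b -> R -> \bar R} {y : R} :
  killed_superharmonic P0 W X L V s ->
  (forall i, measurable_fun setT (F i)) -> (forall i z, (0 <= F i z)%E) ->
  (forall i z, (F i z <= (expR (rho * z) * V z)%:E)%E) -> 0 <= y <= L ->
  (\sum_(i < b) \int[P0]_w F i (y + X w)%R <= (expR (rho * y) * (V y - s y))%:E)%E.
Proof.
move=> [mV V0 Vout Vmean] mF F0 FV yI.
apply: le_trans (sum_children_le mV V0 mF F0 FV) _.
by rewrite EFinM lee_wpmul2l ?Vmean// lee_fin expR_ge0.
Qed.

(* Negative contributions sit on the other side, so that no subtraction occurs in
   [\bar R]. *)
Lemma sum_children_lb {G H : R -> R} {F1 F2 : 'I_b -> R -> \bar R} {y : R} :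
  measurable_fun setT G -> (forall z, 0 <= G z) ->
  measurable_fun setT H -> (forall z, 0 <= H z) ->
  (forall i, measurable_fun setT (F1 i)) -> (forall i z, (0 <= F1 i z)%E) ->
  (forall i, measurable_fun setT (F2 i)) -> (forall i z, (0 <= F2 i z)%E) ->
  (forall i z, ((expR (rho * z) * G z)%:E + F1 i z <=
                F2 i z + (expR (rho * z) * H z)%:E)%E) ->
  ((expR (rho * y))%:E * \int[P0]_w (W w * G (y + X w))%:E +
    \sum_(i < b) \int[P0]_w F1 i (y + X w)%R <=
   \sum_(i < b) \int[P0]_w F2 i (y + X w)%R +
    (expR (rho * y))%:E * \int[P0]_w (W w * H (y + X w))%:E)%E.
Proof.
move=> mG G0 mH H0 mF1 F10 mF2 F20 FV.
rewrite -!sum_children_tilt// -!big_split/=; apply: lee_sum => i _.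
have mF1' := measurable_shift _ y (mF1 i); have mF2' := measurable_shift _ y (mF2 i).
have mG' := measurable_shift _ y (measurable_expM _ mG).
have mH' := measurable_shift _ y (measurable_expM _ mH).
have p (Q : R -> R) : (forall z, 0 <= Q z) ->
    forall w, setT w -> (0 <= (expR (rho * (y + X w)) * Q (y + X w))%:E)%E.
  by move=> Q0 w _; rewrite lee_fin mulr_ge0// expR_ge0.
rewrite -!ge0_integralD//; try by [exact: p|move=> w _; exact: F10|move=> w _; exact: F20].
apply: ge0_le_integral => //.
- by move=> w wT; rewrite adde_ge0// p.
- exact: emeasurable_funD.
- exact: emeasurable_funD.
Qed.

Lemma measurable_EN L k v : measurable_fun setT (fun z => EN L k z v).
Proof.
exact: (measurable_branch_integral Xs _ _ (mI _) (mI _) (I0 _) (I0 _) EFin).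
Qed.

Lemma EN_ge0 L k y v : (0 <= EN L k y v)%E.
Proof. by apply: integral_ge0 => w _; rewrite lee_fin branch_ge0. Qed.

Lemma EN_in L k y v : 0 <= y <= L ->
  (EN L k.+1 y v = 1 + \sum_(i < b) \int[P0]_w EN L k (y + X w)%R (rcons v i))%E.
Proof.
by move=> yI; rewrite (branch_mean X Xs hXs _ _ (mI _) (mI _) (I0 _) (I0 _)) indic_in// mul1e.
Qed.

Lemma EN_out L k y v : ~ (0 <= y <= L) -> (EN L k y v = 0)%E.
Proof.
move=> yI; case: k => [|k]; first by rewrite integral0.
by rewrite (branch_mean X Xs hXs _ _ (mI _) (mI _) (I0 _) (I0 _)) indic_out// mul0e adde0.
Qed.

(** * Upper bounds: mean population, crossings of L, second moment *)

Section upper.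
Variables (L : R) (V U : R -> R).
Hypothesis L1 : 1 <= L.
Hypothesis hV : killed_superharmonic P0 W X L V (fun x => expR (- (th * x))).
Hypothesis bV : forall y : R, 0 <= y <= L -> V y <= C * (L - y + 1) / L.
Hypothesis hU : killed_superharmonic P0 W X L U (fun x => expR (- (th * (L - x)))).

Let thN (y : R) : 0 <= y -> 1 <= expR (rho * y) * expR (- (th * y)).
Proof.
move=> y0; rewrite -expRD -[leLHS]expR0 ler_expR.
have : 0 <= (rho - th) * y.
  by apply: mulr_ge0 => //; have := th0; have := th_rho; lra.
lra.
Qed.

(** The margin, multiplied by e^{rho y}, is at least 1 and pays for the vertex itself. *)
Lemma EN_ub k y v : (EN L k y v <= (expR (rho * y) * V y)%:E)%E.
Proof.
have [mV V0 Vout _] := hV.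
elim: k y v => [|k IH] y v.
  by rewrite integral0 lee_fin mulr_ge0// expR_ge0.
have [yI|/negP yI] := boolP (0 <= y <= L); last first.
  by rewrite EN_out// Vout// mulr0.
rewrite EN_in//.
have := sum_children_ub hV (fun i => measurable_EN L k (rcons v i))
  (fun i z => EN_ge0 L k z (rcons v i)) (fun i z => IH z (rcons v i)) yI.
move=> /(leeD2l 1%E)/le_trans; apply; rewrite -EFinD lee_fin.
by have /andP[y0 _] := yI; have := thN y y0; lra.
Qed.

(** The - 1 is kept because the second moment needs (1 + m)^2, which thus becomes exactly (e^{rho y}
    V y)^2. *)
Lemma sum_EN_ub k y v : 0 <= y <= L ->
  (\sum_(i < b) \int[P0]_w EN L k (y + X w)%R (rcons v i) <=
   (expR (rho * y) * V y - 1)%:E)%E.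
Proof.
move=> yI.
have := sum_children_ub hV (fun i => measurable_EN L k (rcons v i))
  (fun i z => EN_ge0 L k z (rcons v i)) (fun i z => EN_ub k z (rcons v i)) yI.
move=> /le_trans; apply; rewrite lee_fin.
by have /andP[y0 _] := yI; have := thN y y0; lra.
Qed.

(** A child landing at z > L costs e^{- rho z} <= e^{- rho L} e^{th (z - L)} after tilting. The mean
    of this bound is m1 e^{- rho L} e^{- th (L - y)}, which is precisely the margin of m1 e^{- rho
    L} U. *)
Lemma crossing_ub k y v : (\int[P]_w (crossing L k y v w)%:E <=
  (\1_`]L, +oo[%classic y + expR (rho * y) * (m1 * expR (- (rho * L)) * U y))%:E)%E.
Proof.
have [mU U0 Uout Umean] := hU.
have m10 : 0 <= m1.
  by have [_ E1] := hm1; rewrite -lee_fin -E1; apply: integral_ge0 => w _;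
    rewrite lee_fin mulr_ge0 ?expR_ge0// W0.
pose G z := \1_`]L, +oo[%classic z * expR (- (rho * z)).
have G0 z : 0 <= G z by rewrite mulr_ge0// expR_ge0.
have mG : measurable_fun setT G by apply: measurable_funM; [exact: mI|measurable_expr].
pose H z := m1 * expR (- (rho * L)) * U z.
have H0 z : 0 <= H z by rewrite !mulr_ge0// expR_ge0.
have mH : measurable_fun setT H by apply: measurable_funM; [measurable_expr|].
elim: k y v => [|k IH] y v.
  rewrite integral0 lee_fin addr_ge0// mulr_ge0 ?expR_ge0//; exact: H0.
rewrite (branch_mean X Xs hXs _ _ (mI _) (mI _) (I0 _) (I0 _)).
have [yI|/negP yI] := boolP (0 <= y <= L); last first.
  by rewrite indic_out// mul0e adde0 Uout// mulr0 mulr0 addr0.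
rewrite indic_in// mul1e EFinD leeD2l//.
have mGH : measurable_fun setT (fun z => G z + H z) by exact: measurable_funD.
have GH0 z : 0 <= G z + H z by rewrite addr_ge0.
have mC i : measurable_fun setT (fun z => \int[P]_w (crossing L k z (rcons v i) w)%:E)%E.
  exact: (measurable_branch_integral Xs _ _ (mI _) (mI _) (I0 _) (I0 _) EFin).
have C_ge0 (i : 'I_b) z : (0 <= \int[P]_w (crossing L k z (rcons v i) w)%:E)%E.
  by apply: integral_ge0 => w _; rewrite lee_fin branch_ge0.
have CGH (i : 'I_b) z : (\int[P]_w (crossing L k z (rcons v i) w)%:E <=
    (expR (rho * z) * (G z + H z))%:E)%E.
  apply: le_trans (IH _ _) _; rewrite lee_fin /G mulrDr [_ * (\1_ _ _ * _)]mulrCA -expRD.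
  by rewrite subrr expR0 mulr1.
apply: le_trans (sum_children_le mGH GH0 mC C_ge0 CGH) _.
rewrite EFinM lee_wpmul2l ?lee_fin ?expR_ge0//.
have sh (Q : R -> R) : measurable_fun setT Q -> measurable_fun setT (fun z => Q (y + z)).
  by move=> mQ; apply: (measurableT_comp mQ); exact: measurable_funD.
have hG : (\int[P0]_w (W w * G (y + X w))%:E <=
    (expR (- (rho * L)) * expR (- (th * (L - y))) * m1)%:E)%E.
  apply: (has_mean_ub P0 W X W0 mW mX (sh _ mG) (fun z => G0 (y + z)) _
    (has_meanZ P0 W X _ hm1)) => z.
  rewrite /G; have [Lz|zL] := ltP L (y + z); last first.
    have -> : \1_`]L, +oo[%classic (y + z) = 0 :> R.
      by rewrite indicE memNset//= in_itv/= andbT ltNge zL.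
    by rewrite mul0r !mulr_ge0// expR_ge0.
  have -> : \1_`]L, +oo[%classic (y + z) = 1 :> R.
    by rewrite indicE mem_set//= in_itv/= andbT.
  rewrite mul1r -!expRD ler_expR.
  have : 0 <= (rho + th) * (y + z - L).
    by apply: mulr_ge0; [have := rho_gt0; have := th0; lra|lra].
  lra.
have hH : (\int[P0]_w (W w * H (y + X w))%:E <=
    (m1 * expR (- (rho * L)) * (U y - expR (- (th * (L - y)))))%:E)%E.
  under eq_integral do rewrite /H mulrCA EFinM.
  rewrite ge0_integralZl ?lee_fin ?mulr_ge0 ?expR_ge0//; [|exact: measurable_WM|exact: WM_ge0].
  by rewrite [X in (_ <= X)%E]EFinM lee_wpmul2l ?Umean// lee_fin mulr_ge0// expR_ge0.
under eq_integral do rewrite mulrDr EFinD.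
rewrite ge0_integralD//; [|exact: WM_ge0|exact: measurable_WM|exact: WM_ge0|exact: measurable_WM].
apply: le_trans (leeD hG hH) _.
by rewrite -EFinD lee_fin; lra.
Qed.

Let D := 4 * C ^+ 2 / th ^+ 2 * (expR (rho * L) / L ^+ 2).

Let D0 : 0 <= D.
Proof.
apply: mulr_ge0; first by rewrite divr_ge0 ?sqr_ge0// mulr_ge0 ?sqr_ge0.
by rewrite divr_ge0 ?sqr_ge0 ?expR_ge0.
Qed.

(** With t = L - y, the left side carries (t + 1)^2 e^{- rho t}. The square is at most 4 e^{th t} /
    th^2, and 2 th <= rho leaves e^{- th t}, the shape of the margin of U. *)
Let D_ge (y : R) : 0 <= y <= L ->
  (expR (rho * y) * V y) ^+ 2 <= expR (rho * y) * (D * expR (- (th * (L - y)))).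
Proof.
move: (L1) (th0) (th1) (th_rho) (C0) => L1' th0' th1' th_rho' C0'.
move=> /[dup] yI /andP[y0 yL]; have L0 : 0 < L by lra.
have [_ V0 _ _] := hV.
rewrite exprMn [_ ^+ 2 in leLHS]expr2 -mulrA ler_wpM2l ?expR_ge0//.
pose t := L - y; have t0 : 0 <= t by rewrite subr_ge0.
have e : expR (rho * y) = expR (rho * L) * expR (- (rho * t)).
  by rewrite -expRD; congr expR; rewrite /t; ring.
have v2 : V y ^+ 2 <= C ^+ 2 * (t + 1) ^+ 2 / L ^+ 2.
  rewrite -exprMn -expr_div_n lerXn2r// ?nnegrE ?bV//.
  by rewrite divr_ge0 ?mulr_ge0//; lra.
have e2 : (t + 1) ^+ 2 * th ^+ 2 / 4 <= expR (th * t).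
  have -> : expR (th * t) = expR (th * t / 2) ^+ 2.
    by rewrite -expRM_natl; congr expR; field.
  have -> : (t + 1) ^+ 2 * th ^+ 2 / 4 = (th * (t + 1) / 2) ^+ 2 by field.
  rewrite lerXn2r ?nnegrE ?expR_ge0//; first by rewrite divr_ge0// mulr_ge0//; lra.
  by apply: le_trans (expR_ge1Dx _); nra.
have e3 : expR (- (rho * t)) * expR (th * t) <= expR (- (th * t)).
  rewrite -expRD ler_expR; have : 0 <= (rho - 2 * th) * t by rewrite mulr_ge0//; lra.
  lra.
rewrite e; apply: (@le_trans _ _ (expR (rho * L) * expR (- (rho * t)) *
    (C ^+ 2 * (t + 1) ^+ 2 / L ^+ 2))).
  by rewrite ler_wpM2l// mulr_ge0// expR_ge0.
have -> : expR (rho * L) * expR (- (rho * t)) * (C ^+ 2 * (t + 1) ^+ 2 / L ^+ 2) =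
    D * (expR (- (rho * t)) * ((t + 1) ^+ 2 * th ^+ 2 / 4)).
  by rewrite /D; field; rewrite !gt_eqF.
rewrite ler_wpM2l//.
by apply: le_trans e3; rewrite ler_wpM2l// expR_ge0.
Qed.

(** The source term (e^{rho y} V y)^2 is concentrated near L, so the barrier U scaled by [D] absorbs
    it. *)
Lemma second_moment_ub k y v : (\int[P]_w (N L k y v w ^+ 2)%:E <=
  (expR (rho * y) * (D * U y))%:E)%E.
Proof.
have [mV V0 Vout Vmean] := hV.
have [mU U0 Uout Umean] := hU.
have hDU : killed_superharmonic P0 W X L (fun z => D * U z)
    (fun z => D * expR (- (th * (L - z)))).
  split.
  - by apply: measurable_funM; [measurable_expr|].
  - by move=> z; rewrite mulr_ge0.
  - by move=> z zI; rewrite Uout// mulr0.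
  - move=> z zI; under eq_integral do rewrite mulrCA EFinM.
    rewrite ge0_integralZl ?lee_fin//; [|exact: measurable_WM|exact: WM_ge0].
    by rewrite -mulrBr [X in (_ <= X)%E]EFinM lee_wpmul2l ?Umean.
have msqr : measurable_fun setT (fun z : R => (z ^+ 2)%:E).
  exact/measurable_EFinP/measurable_funX.
have sqr0 (z : R) : 0 <= z -> (0 <= (z ^+ 2)%:E)%E by rewrite lee_fin sqr_ge0.
elim: k y v => [|k IH] y v.
  under eq_integral do rewrite expr0n/=.
  by rewrite integral0 lee_fin mulr_ge0 ?expR_ge0// mulr_ge0.
have mN2 i : measurable_fun setT (fun z => \int[P]_w (N L k z (rcons v i) w ^+ 2)%:E)%E.
  exact: (measurable_branch_integral Xs _ _ (mI _) (mI _) (I0 _) (I0 _) _ _ _ msqr sqr0).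
have N20 (i : 'I_b) z : (0 <= \int[P]_w (N L k z (rcons v i) w ^+ 2)%:E)%E.
  by apply: integral_ge0 => w _; rewrite lee_fin sqr_ge0.
have [yI|/negP yI] := boolP (0 <= y <= L); last first.
  rewrite Uout// !mulr0 /= indic_out//.
  under eq_integral do rewrite mul0r addr0 expr0n/=.
  by rewrite integral0.
have := branch_second_moment X Xs hXs _ (measurable_itv `[0, L]) k y v _ _
  (sum_EN_ub k y v yI) (sum_children_ub hDU mN2 N20 (fun i z => IH z (rcons v i)) yI).
rewrite indic_in// mul1r => /le_trans; apply; rewrite lee_fin.
have := D_ge y yI; lra.
Qed.

End upper.

(** * Lower bound for the mean of N_l - N_{l-1-K} *)

Section lower.
Hypothesis hb : (2 <= b)%N.
Variable c3 : R.
Hypotheses (h1 : has_mean P0 W X (fun=> 1) 1) (hid : has_mean P0 W X id 0)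
  (hrho : has_mean P0 W X (fun y => expR (- (rho * y))) b%:R)
  (hm2 : has_mean P0 W X (fun y => expR (th * y) ^+ 2) m2)
  (hpos : has_mean P0 W X (fun y => Num.max y 0) c3).
Variables (l K : R) (V : R -> R).
Hypotheses (l1 : 1 <= l) (m11 : 1 < m1) (K0 : 0 <= K).
Hypothesis hK : (1 + th^-1) * m2 * expR (- (th * K)) <= m1 - 1.
Hypothesis hV : killed_superharmonic P0 W X l V (fun x => expR (- (th * x))).
Hypothesis bV : forall y : R, 0 <= y <= l -> V y <= C * (l - y + 1) / l.

(** Normalised so that cutting the ramp below 0 costs at most e^{- rho y} in the mean, that is 1
    after multiplication by e^{rho y}: the contribution of the vertex itself. *)
Definition slope : R := (b%:R * (1 + rho^-1))^-1.
Local Notation c := slope.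

Let slopeV_gt0 : 0 < b%:R * (1 + rho^-1).
Proof.
apply: mulr_gt0; first by rewrite ltr0n (ltn_trans _ hb).
by apply: addr_gt0; rewrite ?invr_gt0.
Qed.

Let c0 : 0 < c. Proof. by rewrite invr_gt0. Qed.

Let cE : c * (1 + rho^-1) * b%:R = 1.
Proof. by rewrite -mulrA [_ * b%:R]mulrC mulVf// gt_eqF. Qed.

Definition ramp (y : R) : R := \1_`[0, l]%classic y * (c * (l - y) / l).

Let ramp_in (y : R) : 0 <= y <= l -> ramp y = c * (l - y) / l.
Proof. by move=> yI; rewrite /ramp indic_in// mul1r. Qed.

Let ramp_out (y : R) : ~ (0 <= y <= l) -> ramp y = 0.
Proof. by move=> yI; rewrite /ramp indic_out// mul0r. Qed.

Let ramp_ge0 y : 0 <= ramp y.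
Proof.
have [yI|/negP yI] := boolP (0 <= y <= l); last by rewrite ramp_out.
have /andP[_ yl] := yI; rewrite ramp_in// divr_ge0//; last by have := l1; lra.
by rewrite mulr_ge0// ?subr_ge0// ltW.
Qed.

Let measurable_ramp : measurable_fun setT ramp.
Proof. by apply: measurable_funM; [exact: mI|measurable_expr]. Qed.

Let measurable_add {f : R -> R} (y : R) : measurable_fun setT f ->
  measurable_fun setT (fun z : R => f (y + z)).
Proof. by move=> mf; apply: (measurableT_comp mf); exact: measurable_funD. Qed.

(** The affine function minus c (1 + 1/rho) e^{- rho z} lies below the ramp everywhere: it is
    negative above l, and below 0 the exponential outgrows 1 - z. The mean of e^{- rho X} is b,
    which [slope] cancels. *)
Lemma ramp_mean (y : R) : 0 <= y <= l ->
  ((ramp y - expR (- (rho * y)))%:E <= \int[P0]_w (W w * ramp (y + X w))%:E)%E.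
Proof.
move=> yI; move: (l1) (rho_gt0) (c0) => l1' r0 c0'; have l0 : 0 < l by lra.
have H := has_meanD P0 W X (has_meanD P0 W X (has_meanZ P0 W X (c * (l - y) / l) h1)
  (has_meanZ P0 W X (- (c / l)) hid))
  (has_meanZ P0 W X (- (c * (1 + rho^-1) * expR (- (rho * y)))) hrho).
rewrite ramp_in//.
have -> : c * (l - y) / l - expR (- (rho * y)) = c * (l - y) / l * 1 + - (c / l) * 0 +
    - (c * (1 + rho^-1) * expR (- (rho * y))) * b%:R.
  by rewrite mulr1 mulr0 addr0 mulNr [_ * b%:R]mulrAC cE mul1r.
apply: (has_mean_lb P0 W X W0 mW mX (measurable_add y measurable_ramp)
  (fun z => ramp_ge0 (y + z)) _ H) => u.
have -> : c * (l - y) / l * 1 + - (c / l) * id u = c * ((l - (y + u)) / l).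
  by rewrite /=; field; rewrite gt_eqF.
have -> : - (c * (1 + rho^-1) * expR (- (rho * y))) * expR (- (rho * u)) =
    - (c * ((1 + rho^-1) * expR (- (rho * (y + u))))).
  have -> : expR (- (rho * (y + u))) = expR (- (rho * y)) * expR (- (rho * u)).
    by rewrite -expRD; congr expR; ring.
  ring.
move: (y + u) => z {u}.
have e0 := expR_gt0 (- (rho * z)).
have ri : 0 < rho^-1 by rewrite invr_gt0.
have p0 : 0 <= c * ((1 + rho^-1) * expR (- (rho * z))).
  by rewrite mulr_ge0 ?ltW// mulr_gt0// addr_gt0.
have [zI|] := boolP (0 <= z <= l).
  by rewrite ramp_in// mulrA; lra.
move=> /[dup] /negP zI; rewrite ramp_out// negb_and -!ltNge => /orP[z0|zl].
  rewrite -mulrBr; apply: mulr_ge0_le0; [exact: ltW|rewrite subr_le0].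
  have e1 := expR_ge1Dx (- (rho * z)).
  have e2 : 1 <= expR (- (rho * z)) by apply: le_trans e1; nra.
  have e3 : - z <= rho^-1 * expR (- (rho * z)) by rewrite ler_pdivlMl//; lra.
  have e4 : (l - z) / l <= 1 - z by rewrite ler_pdivrMr//; nra.
  lra.
have : c * ((l - z) / l) <= 0.
  apply: mulr_ge0_le0; first exact: ltW.
  by rewrite mulr_le0_ge0 ?invr_ge0 ?(ltW l0)//; lra.
lra.
Qed.

(** V is at most 2C + 1 and its margin at least e^{- th l} on [0, l], so one killed step shrinks V
    by this factor. *)
Let lam : R := 1 - expR (- (th * l)) / (2 * C + 1).

Let lam01 : 0 <= lam < 1.
Proof.
have e0 := expR_gt0 (- (th * l)).
have e1 : expR (- (th * l)) <= 1.
  by rewrite -[leRHS]expR0 ler_expR oppr_le0 mulr_ge0// ?ltW//; have := l1; lra.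
have C1 : 0 < 2 * C + 1 by have := C0; lra.
apply/andP; split; last by rewrite /lam ltrBlDr ltrDl divr_gt0.
by rewrite /lam subr_ge0 ler_pdivrMr// mul1r; have := C0; lra.
Qed.

Let lamV (y : R) : 0 <= y <= l -> V y - expR (- (th * y)) <= lam * V y.
Proof.
move=> /[dup] yI /andP[y0 yl]; move: (C0) (l1) (th0) => C0' l1' th0'.
have C1 : 0 < 2 * C + 1 by lra.
have e0 := expR_gt0 (- (th * l)).
have V1 : V y <= 2 * C + 1.
  apply: le_trans (bV y yI) _; rewrite ler_pdivrMr; last by lra.
  nra.
have e1 : expR (- (th * l)) <= expR (- (th * y)) by rewrite ler_expR lerN2 ler_pM2l.
have V0 := ks_ge0 hV y.
have e2 : expR (- (th * l)) / (2 * C + 1) * V y <= expR (- (th * y)).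
  apply: le_trans e1; rewrite mulrAC ler_pdivrMr// ler_wpM2l// ltW//.
by rewrite /lam; lra.
Qed.

(* Error of truncating at depth k: the killed walk contracts V by the factor lam. *)
Definition remainder (k : nat) : R := c * expR (th * l) * lam ^+ k.
Local Notation r := remainder.

Let r_ge0 k : 0 <= r k.
Proof.
have /andP[lam0 _] := lam01.
by rewrite mulr_ge0 ?exprn_ge0// mulr_ge0 ?expR_ge0// ltW.
Qed.

Let rV_ge0 k z : 0 <= r k * V z.
Proof. by rewrite mulr_ge0// (ks_ge0 hV). Qed.

Let measurable_rV k : measurable_fun setT (fun z => r k * V z).
Proof. by apply: measurable_funM; [measurable_expr|exact: ks_measurable hV]. Qed.

Let V_ge (y : R) : 0 <= y <= l -> expR (- (th * y)) <= V y.
Proof.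
move=> yI; rewrite -subr_ge0 -lee_fin; apply: le_trans (ks_mean hV _ yI).
apply: integral_ge0 => w _; rewrite lee_fin mulr_ge0 ?W0//; exact: ks_ge0 hV _.
Qed.

Let rV_mean k (y : R) : 0 <= y <= l ->
  ((expR (rho * y))%:E * \int[P0]_w (W w * (r k * V (y + X w)))%:E <=
   (expR (rho * y) * (r k.+1 * V y))%:E)%E.
Proof.
move=> yI; rewrite [X in (_ <= X)%E]EFinM lee_wpmul2l ?lee_fin ?expR_ge0//.
under eq_integral do rewrite mulrCA EFinM.
rewrite ge0_integralZl ?lee_fin//; last 2 first.
- exact: measurable_WM y (ks_measurable hV).
- exact: WM_ge0 y (ks_ge0 hV).
apply: le_trans (_ : _ <= (r k)%:E * (lam * V y)%:E)%E _; last first.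
  by rewrite -EFinM lee_fin /r exprS; lra.
rewrite lee_wpmul2l ?lee_fin//; apply: le_trans (ks_mean hV _ yI) _.
by rewrite lee_fin lamV.
Qed.

(** The factor e^{th l} in [remainder] is there for this: V y >= e^{- th y} >= e^{- th l}, so at
    depth 0 the remainder already covers the ramp. *)
Let r0V (y : R) : 0 <= y <= l -> c <= r 0 * V y.
Proof.
move=> /[dup] yI /andP[y0 yl]; rewrite /r expr0 mulr1.
apply: le_trans (_ : c * (expR (th * l) * expR (- (th * y))) <= _); last first.
  by rewrite mulrA ler_wpM2l ?V_ge// mulr_ge0 ?expR_ge0// ltW.
rewrite -expRD -mulrBr -[leLHS]mulr1 ler_wpM2l// ?(ltW c0)// -[leLHS]expR0 ler_expR.
by rewrite mulr_ge0 ?subr_ge0// ltW.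
Qed.

Let ramp_le (y : R) : 0 <= y <= l -> ramp y <= c.
Proof.
move=> /[dup] yI /andP[y0 yl]; have := l1; move=> l1'.
by rewrite ramp_in// ler_pdivrMr ?ler_wpM2l ?(ltW c0)//; lra.
Qed.

Lemma EN_lb k y v : ((expR (rho * y) * ramp y)%:E <=
  EN l k y v + (expR (rho * y) * (r k * V y))%:E)%E.
Proof.
elim: k y v => [|k IH] y v.
  rewrite integral0 add0e lee_fin ler_wpM2l ?expR_ge0//.
  have [yI|/negP yI] := boolP (0 <= y <= l).
    by apply: le_trans (ramp_le y yI) (r0V y yI).
  by rewrite ramp_out.
have [yI|/negP yI] := boolP (0 <= y <= l); last first.
  by rewrite ramp_out// mulr0 adde_ge0 ?EN_ge0// lee_fin mulr_ge0// expR_ge0.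
rewrite EN_in//.
have := sum_children_lb (y := y) measurable_ramp ramp_ge0 (measurable_rV k) (rV_ge0 k)
  (F1 := fun i z => 0%E) (fun i => measurable_cst _) (fun i z => lexx _)
  (fun i => measurable_EN l k (rcons v i)) (fun i z => EN_ge0 l k z (rcons v i)) _.
have H i z : ((expR (rho * z) * ramp z)%:E + 0 <= EN l k z (rcons v i) +
    (expR (rho * z) * (r k * V z))%:E)%E by rewrite adde0.
move=> /(_ H); under [X in (_ + X <= _)%E -> _]eq_bigr do rewrite integral0.
rewrite big1// adde0 => h.
rewrite -addeA; apply: (@le_trans _ _ (1 + (expR (rho * y))%:E *
    \int[P0]_w (W w * ramp (y + X w))%:E)%E); last first.
  rewrite leeD2l//; apply: le_trans h _; rewrite leeD2l//; exact: rV_mean.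
apply: (@le_trans _ _ (1 + (expR (rho * y))%:E * (ramp y - expR (- (rho * y)))%:E)%E).
  by rewrite -EFinM -EFinD lee_fin mulrBr -expRD subrr expR0; lra.
by rewrite leeD2l// lee_wpmul2l ?ramp_mean// lee_fin expR_ge0.
Qed.

(** A point above l - 1 lies more than K above j, so [e] exceeds e^{th K} there, while it is at most
    1 up to j. *)
Let j : R := l - 1 - K.

Let e (z : R) : R := expR (th * z) * expR (- (th * j)).

Let e_gt0 z : 0 < e z. Proof. by rewrite mulr_gt0 ?expR_gt0. Qed.

Let eE z : e z = expR (th * (z - j)). Proof. by rewrite /e -expRD; congr expR; ring. Qed.

Let e_le z z' : z <= z' -> e z <= e z'.
Proof. by move=> zz; rewrite !eE ler_expR ler_pM2l// lerD2r. Qed.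

(* Affine up to an exponential whose gain below j pays for the jumps above l - 1. *)
Definition hump (z : R) : R :=
  \1_`[0, l - 1]%classic z * (z + l * (e z - e 0)).

Let hump_in (z : R) : 0 <= z <= l - 1 -> hump z = z + l * (e z - e 0).
Proof. by move=> zI; rewrite /hump indic_in// mul1r. Qed.

Let hump_out (z : R) : ~ (0 <= z <= l - 1) -> hump z = 0.
Proof. by move=> zI; rewrite /hump indic_out// mul0r. Qed.

Lemma hump_ge (z : R) : 0 <= z <= l - 1 -> z <= hump z.
Proof.
move=> /[dup] zI /andP[z0 _]; rewrite hump_in// lerDl mulr_ge0 ?subr_ge0 ?e_le//.
by have := l1; lra.
Qed.

Let hump_ge0 z : 0 <= hump z.
Proof.
have [zI|/negP zI] := boolP (0 <= z <= l - 1); last by rewrite hump_out.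
by apply: le_trans (hump_ge z zI); have /andP[] := zI.
Qed.

Let measurable_hump : measurable_fun setT hump.
Proof. by rewrite /hump /e; apply: measurable_funM; [exact: mI|measurable_expr]. Qed.

(** The minorant z + l (e z - e 0) - l q (e z)^2, with q = (1 + 1/th) e^{- th K}, is negative above
    l - 1, where the square beats both z and l e z. For y <= j the square costs at most the gain l
    e(y) (m1 - 1), which is what [hK] says. *)
Lemma hump_mean (y : R) : 0 <= y <= j ->
  ((hump y)%:E <= \int[P0]_w (W w * hump (y + X w))%:E)%E.
Proof.
move=> /andP[y0 yj]; move: (l1) (th0) (th1) (K0) (hK) (m11) => l1' th0' th1' K0' hK' m11'.
have l0 : 0 < l by lra.
have ti : 0 < th^-1 by rewrite invr_gt0.
pose q := (1 + th^-1) * expR (- (th * K)).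
have q0 : 0 < q by rewrite mulr_gt0 ?expR_gt0// addr_gt0.
have H := has_meanD P0 W X (has_meanD P0 W X (has_meanD P0 W X
  (has_meanZ P0 W X (y - l * e 0) h1) hid)
  (has_meanZ P0 W X (l * e y) hm1)) (has_meanZ P0 W X (- (l * q * e y ^+ 2)) hm2).
apply: (@le_trans _ _ ((y - l * e 0) * 1 + 0 + l * e y * m1 +
    - (l * q * e y ^+ 2) * m2)%:E).
  rewrite lee_fin hump_in; last by rewrite y0 (le_trans yj)// /j; lra.
  have ey := e_gt0 y.
  have ey1 : e y <= 1.
    rewrite eE -[leRHS]expR0 ler_expR; apply: mulr_ge0_le0; first exact: ltW.
    by rewrite subr_le0.
  have qm : q * m2 <= m1 - 1 by rewrite /q mulrAC.
  have qe : q * m2 * e y <= m1 - 1.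
    have [qm0|qm0] := leP 0 (q * m2); first by apply: le_trans qm; rewrite ler_piMr.
    by apply: (@le_trans _ _ 0); [apply: mulr_le0_ge0; exact: ltW|lra].
  have : 0 <= l * (e y * (m1 - 1 - q * m2 * e y)).
    by apply: mulr_ge0; [exact: ltW|apply: mulr_ge0; [exact: ltW|lra]].
  lra.
apply: (has_mean_lb P0 W X W0 mW mX (measurable_add y measurable_hump)
  (fun z => hump_ge0 (y + z)) _ H) => u.
have exy : e (y + u) = e y * expR (th * u).
  by rewrite /e mulrDr expRD; ring.
have -> : (y - l * e 0) * 1 + id u + l * e y * expR (th * u) +
    - (l * q * e y ^+ 2) * expR (th * u) ^+ 2 =
    y + u + l * (e (y + u) - e 0) - l * q * e (y + u) ^+ 2.
  by rewrite exy /=; ring.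
move: (y + u) => z {u exy H}.
have ez := e_gt0 z.
have p0 : 0 <= l * q * e z ^+ 2.
  by apply: mulr_ge0; [apply: mulr_ge0; exact: ltW|exact: sqr_ge0].
have [zI|] := boolP (0 <= z <= l - 1); first by rewrite hump_in//; lra.
move=> /[dup] /negP zI; rewrite hump_out// negb_and -!ltNge => /orP[z0|zl].
  have : l * (e z - e 0) <= 0.
    by apply: mulr_ge0_le0; [exact: ltW|rewrite subr_le0 e_le// ltW].
  lra.
have zj : K < z - j by rewrite /j; lra.
have h2 : 1 + th * (z - j) <= e z by rewrite eE expR_ge1Dx.
have h3 : z <= l * (th^-1 * e z).
  have h4 : 1 + (z - j) <= th^-1 * e z.
    rewrite ler_pdivlMl//; apply: le_trans h2; lra.
  have jl : j <= l by rewrite /j; lra.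
  apply: (@le_trans _ _ (l * (1 + (z - j)))); first nra.
  by apply: ler_wpM2l => //; exact: ltW.
have h5 : 1 <= expR (- (th * K)) * e z.
  rewrite eE -expRD -[leLHS]expR0 ler_expR.
  have : 0 <= th * (z - j - K) by apply: mulr_ge0; [exact: ltW|lra].
  lra.
have h6 : l * ((1 + th^-1) * e z) <= l * q * e z ^+ 2.
  have -> : l * q * e z ^+ 2 = l * ((1 + th^-1) * e z * (expR (- (th * K)) * e z)).
    by rewrite /q; ring.
  apply: ler_wpM2l; first exact: ltW.
  by apply: ler_peMr => //; apply/ltW/mulr_gt0 => //; exact: addr_gt0.
have : 0 <= l * e 0 by apply: mulr_ge0; exact: ltW.
lra.
Qed.

(** [hump] vanishes at 0, so near the origin its own value gives nothing. After one step its mean is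
    at least that of the positive part of X, up to an error exponentially small in l; this supplies
    the 1 in the factor 1 + x. *)
Lemma hump_mean_origin (y : R) : 0 <= y ->
  ((c3 - th^-1 * expR (- (th * (l - 1))) * expR (th * y) ^+ 2 * m2)%:E <=
   \int[P0]_w (W w * hump (y + X w))%:E)%E.
Proof.
move=> y0; move: (th0) (l1) => th0' l1'.
have H := has_meanD P0 W X hpos (has_meanZ P0 W X
  (- (th^-1 * expR (- (th * (l - 1))) * expR (th * y) ^+ 2)) hm2).
rewrite -mulNr.
apply: (has_mean_lb P0 W X W0 mW mX (measurable_add y measurable_hump)
  (fun z => hump_ge0 (y + z)) _ H) => u.
set A := _ * expR (th * u) ^+ 2.
have AE : A = - (th^-1 * (expR (th * (y + u)) * expR (th * (y + u - (l - 1))))).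
  have -> : expR (th * (y + u)) * expR (th * (y + u - (l - 1))) =
      expR (- (th * (l - 1))) * (expR (th * y) ^+ 2 * expR (th * u) ^+ 2).
    rewrite -!expRM_natl -!expRD; congr expR; ring.
  by rewrite /A; ring.
have ti : 0 < th^-1 by rewrite invr_gt0.
have A0 : A <= 0.
  by rewrite AE oppr_le0 ltW// !mulr_gt0// ?expR_gt0.
have [zI|] := boolP (0 <= y + u <= l - 1).
  have := hump_ge _ zI; have /andP[z0 _] := zI.
  by have [u0|u0] := leP 0 u; lra.
move=> /[dup] /negP zI; rewrite hump_out// negb_and -!ltNge => /orP[z0|zl].
  by rewrite max_r ?add0r//; lra.
have h2 : y + u <= th^-1 * expR (th * (y + u)).
  by rewrite ler_pdivlMl//; have := expR_ge1Dx (th * (y + u)); lra.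
have h3 : 1 <= expR (th * (y + u - (l - 1))).
  by rewrite -[leLHS]expR0 ler_expR; apply: mulr_ge0; [exact: ltW|lra].
have h4 : y + u <= - A.
  apply: le_trans h2 _; rewrite AE opprK; apply: ler_wpM2l; first exact: ltW.
  by apply: ler_peMr => //; exact: expR_ge0.
by have [u0|u0] := leP 0 u; lra.
Qed.

Let Cf : R := 1 + expR (th * K).

(** As Cf l bounds [hump], the scaled hump is at most c / l. The ramp is at least c / l on
    [0, l - 1], which is why [hump] stops one unit before l. *)
Definition scale : R := c / (Cf * l ^+ 2).

Let l_gt0 : 0 < l. Proof. by have := l1; lra. Qed.
Let Cf0 : 0 < Cf. Proof. by rewrite addr_gt0 ?expR_gt0. Qed.

Let scale_gt0 : 0 < scale.
Proof. by rewrite divr_gt0// mulr_gt0// exprn_gt0. Qed.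

Let hump_le_ramp (z : R) : 0 <= z <= l - 1 -> scale * hump z <= ramp z.
Proof.
move=> /[dup] zI /andP[z0 zl]; move: (l1) => l1'.
have h2 : hump z <= Cf * l.
  rewrite hump_in// /Cf.
  have : e z <= expR (th * K).
    by rewrite eE ler_expR ler_pM2l//; rewrite /j; lra.
  have := e_gt0 0; nra.
rewrite ramp_in; last by rewrite z0; lra.
apply: (@le_trans _ _ (c / l)); last first.
  apply: ler_wpM2r; first by rewrite invr_ge0 ltW.
  by apply: ler_peMr; [exact: ltW|lra].
apply: (@le_trans _ _ (scale * (Cf * l))).
  by apply: ler_wpM2l => //; exact: ltW.
by rewrite /scale le_eqVlt; apply/orP; left; apply/eqP; field; rewrite !gt_eqF.
Qed.

Let EN_mono k y v : (EN j k y v <= EN l k y v)%E.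
Proof.
apply: ge0_le_integral => //.
- by move=> w _; rewrite lee_fin branch_ge0.
- exact/measurable_EFinP/(measurable_branchXs Xs _ _ (mI _) (mI _)).
- exact/measurable_EFinP/(measurable_branchXs Xs _ _ (mI _) (mI _)).
move=> w _; rewrite lee_fin; apply: le_branch => z.
  rewrite I0/=; have [zI|/negP zI] := boolP (0 <= z <= j); last by rewrite indic_out.
  have /andP[z0 zj] := zI; rewrite !indic_in// z0/=.
  by apply: (le_trans zj); rewrite /j; have := K0; lra.
rewrite I0/=; have [zI|/negP zI] := boolP (0 <= z <= j); last by rewrite indic_out.
have /andP[z0 zj] := zI; rewrite !indic_in// z0/=.
by apply: (le_trans zj); rewrite /j; have := K0; lra.
Qed.

(** For y in [0, j] the vertex is counted by both populations and cancels, so only one-step means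
    remain. *)
Let step k (y : R) v : 0 <= y <= j ->
  (forall z u, ((expR (rho * z) * (scale * hump z))%:E + EN j k z u <=
    EN l k z u + (expR (rho * z) * (r k * V z))%:E)%E) ->
  ((expR (rho * y) * scale)%:E * \int[P0]_w (W w * hump (y + X w))%:E + EN j k.+1 y v <=
    EN l k.+1 y v + (expR (rho * y) * (r k.+1 * V y))%:E)%E.
Proof.
move=> /[dup] yI /andP[y0 yj] IH.
have yl : 0 <= y <= l.
  by rewrite y0/=; apply: (le_trans yj); rewrite /j; have := K0; lra.
have msh : measurable_fun setT (fun z => scale * hump z).
  by apply: measurable_funM; [exact: measurable_cst|exact: measurable_hump].
have sh0 z : 0 <= scale * hump z by rewrite mulr_ge0 ?hump_ge0// ltW.
have := sum_children_lb (y := y) msh sh0 (measurable_rV k) (rV_ge0 k)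
  (fun i => measurable_EN j k (rcons v i)) (fun i z => EN_ge0 j k z (rcons v i))
  (fun i => measurable_EN l k (rcons v i)) (fun i z => EN_ge0 l k z (rcons v i))
  (fun i z => IH z (rcons v i)).
under eq_integral do rewrite mulrCA EFinM.
rewrite ge0_integralZl; last 4 first.
- by [].
- exact: measurable_WM y measurable_hump.
- exact: WM_ge0 y hump_ge0.
- by rewrite lee_fin ltW.
rewrite muleA -EFinM => h.
rewrite !EN_in// addeCA -addeA leeD2l//.
by apply: le_trans h _; rewrite leeD2l// rV_mean.
Qed.

Lemma EN_gap k (y : R) v : ((expR (rho * y) * (scale * hump y))%:E + EN j k y v <=
  EN l k y v + (expR (rho * y) * (r k * V y))%:E)%E.
Proof.
elim: k y v => [|k IH] y v.
  rewrite !integral0 adde0 add0e lee_fin ler_wpM2l ?expR_ge0//.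
  have [yI|/negP yI] := boolP (0 <= y <= l - 1); last by rewrite hump_out// mulr0.
  have yl : 0 <= y <= l by have /andP[-> yl] := yI; lra.
  apply: le_trans (hump_le_ramp y yI) _.
  by apply: le_trans (ramp_le y yl) (r0V y yl).
have [yI|/negP yI] := boolP (0 <= y <= l - 1); last first.
  rewrite hump_out// !mulr0 add0e; apply: le_trans (EN_mono _ _ _) _.
  by rewrite leeDl// lee_fin mulr_ge0// expR_ge0.
have [yj|jy] := leP y j; last first.
  rewrite [EN j _ _ _]EN_out ?adde0; last first.
    by apply/negP; rewrite negb_and -!ltNge jy orbT.
  apply: le_trans (EN_lb k.+1 y v).
  by rewrite lee_fin ler_wpM2l ?expR_ge0// hump_le_ramp.
have yI' : 0 <= y <= j by have /andP[-> _] := yI.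
apply: le_trans (step k y v yI' IH); rewrite leeD2r//.
by rewrite mulrA EFinM lee_wpmul2l ?hump_mean// lee_fin mulr_ge0 ?expR_ge0// ltW.
Qed.

Lemma EN_gap_start (y a : R) : 0 <= y <= j -> 0 < a ->
  (a%:E <= \int[P0]_w (W w * hump (y + X w))%:E)%E ->
  exists k, ((expR (rho * y) * scale * (a / 2))%:E + EN j k y [::] <= EN l k y [::])%E.
Proof.
move=> yI a0 ha.
have V0 := ks_ge0 hV y.
have A0 : 0 < expR (rho * y) * scale by rewrite mulr_gt0 ?expR_gt0.
have [k hk] : exists k, r k.+1 * V y <= scale * (a / 2).
  pose M := c * expR (th * l) * V y + 1.
  have M0 : 0 < M by rewrite ltr_wpDl// mulr_ge0// mulr_ge0 ?expR_ge0 ?ltW.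
  have e0 : 0 < scale * (a / 2) / M by rewrite !divr_gt0// mulr_gt0// divr_gt0.
  have /andP[lam0 lam1] := lam01.
  have lam_cvg : lam ^+ n @[n --> \oo] --> (0 : R) by apply: cvg_expr; rewrite ger0_norm.
  have /cvgr0Pnorm_lt/(_ _ e0)[k _ hk] := lam_cvg.
  exists k; have := hk k.+1 (leqnSn k); rewrite /= ger0_norm ?exprn_ge0//.
  rewrite ltr_pdivlMr// => /ltW; apply: le_trans.
  rewrite /r mulrAC [leRHS]mulrC; apply: ler_wpM2r; first exact: exprn_ge0.
  by rewrite /M lerDl.
exists k.+1.
have lfin : EN l k.+1 y [::] \is a fin_num.
  rewrite ge0_fin_numE ?EN_ge0//.
  exact: le_lt_trans (EN_ub l V hV _ _ _) (ltry _).
have jfin : EN j k.+1 y [::] \is a fin_num.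
  rewrite ge0_fin_numE ?EN_ge0//; apply: le_lt_trans (EN_mono _ _ _) _.
  by rewrite -ge0_fin_numE ?EN_ge0.
have := step k y [::] yI (EN_gap k).
have h : ((expR (rho * y) * scale * a)%:E <= (expR (rho * y) * scale)%:E *
    \int[P0]_w (W w * hump (y + X w))%:E)%E.
  by rewrite EFinM lee_wpmul2l// lee_fin ltW.
move=> /(le_trans (leeD2r _ h)).
rewrite -(fineK lfin) -(fineK jfin) -!EFinD !lee_fin => h'.
have : expR (rho * y) * (r k.+1 * V y) <= expR (rho * y) * (scale * (a / 2)).
  by rewrite ler_wpM2l ?expR_ge0.
lra.
Qed.

End lower.

End estimates.

(** * From moments to tails *)

Section tail.
Context {R : realType} {b : nat}.
Context {d : measure_display} {T : measurableType d} {P : probability T R}.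
Variable Xs : vertex b -> {RV P >-> R}.

Local Notation N L k y w :=
  (branch \1_`[0, L]%classic \1_`[0, L]%classic k y [::] (fun u => Xs u w)).
Local Notation crossing L k y w :=
  (branch \1_`]L, +oo[%classic \1_`[0, L]%classic k y [::] (fun u => Xs u w)).
Local Notation Z k y w :=
  (branch \1_[set z : R | 0 <= z] \1_[set z : R | 0 <= z] k y [::] (fun u => Xs u w)).

Let I0 (A : set R) (y : R) : 0 <= \1_A y :> R. Proof. by rewrite indicE. Qed.
Let mI (i : interval R) : measurable_fun setT (\1_[set` i] : R -> R).
Proof. exact: measurable_indic. Qed.

Let nonneg_itv : [set z : R | 0 <= z] = `[0, +oo[%classic.
Proof. by apply/seteqP; split => z /=; rewrite in_itv/= andbT. Qed.

Let mZ k y : measurable_fun setT (fun w => Z k y w).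
Proof. by rewrite nonneg_itv; exact: measurable_branchXs. Qed.
Let mN L k y : measurable_fun setT (fun w => (N L k y w)%:E).
Proof. by apply/measurable_EFinP; exact: measurable_branchXs. Qed.
Let mC L k y : measurable_fun setT (fun w => (crossing L k y w)%:E).
Proof. by apply/measurable_EFinP; exact: measurable_branchXs. Qed.
Let mN2 L k y : measurable_fun setT (fun w => (N L k y w ^+ 2)%:E).
Proof. by apply/measurable_EFinP/measurable_funX; exact: measurable_branchXs. Qed.
Let C_ge0 L k y w : 0 <= crossing L k y w. Proof. exact: branch_ge0. Qed.
Let N_ge0 L k y w : 0 <= N L k y w. Proof. exact: branch_ge0. Qed.

Definition progeny_gt (x : R) (n k : nat) : set T := [set w | n%:R < Z k x w].

Let measurable_progeny_gt x n k : measurable (progeny_gt x n k).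
Proof.
have -> : progeny_gt x n k = (fun w => Z k x w) @^-1` `]n%:R, +oo[%classic.
  by apply/seteqP; split => w; rewrite /progeny_gt /= in_itv/= andbT.
by rewrite -[X in measurable X]setTI; exact: mZ.
Qed.

Let progeny_gt_union x n :
  [set w | (n%:R%:E < total_progeny x (fun u => Xs u w))%E] =
  \bigcup_k progeny_gt x n k.
Proof.
apply/seteqP; split => w /=.
  by move/total_progeny_gt => [k hk]; exists k.
by move=> [k _ hk]; apply/total_progeny_gt; exists k.
Qed.

Lemma progeny_tail_ub x n (B : \bar R) : (forall k, (P (progeny_gt x n k) <= B)%E) ->
  (P [set w | (n%:R%:E < total_progeny x (fun u => Xs u w))%E] <= B)%E.
Proof.
move=> hB; rewrite progeny_gt_union.
have nd : nondecreasing_seq (progeny_gt x n).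
  apply/nondecreasing_seqP => k; apply/subsetPset => w /= h.
  by apply: (lt_le_trans h); exact: branch_le_depth.
have h := @nondecreasing_cvg_mu _ _ _ P _ (measurable_progeny_gt x n)
  (bigcupT_measurable _ (measurable_progeny_gt x n)) nd.
by apply: (cvge_to_le h); apply: nearW => k; exact: hB.
Qed.

Lemma progeny_tail_lb x n k :
  (P (progeny_gt x n k) <= P [set w | (n%:R%:E < total_progeny x (fun u => Xs u w))%E])%E.
Proof.
rewrite progeny_gt_union; apply: le_measure.
- exact/mem_set.
- exact/mem_set/bigcupT_measurable.
- by move=> w h; exists k.
Qed.

Let P_indic x n k :
  (P (progeny_gt x n k) = \int[P]_w (\1_(progeny_gt x n k) w : R)%:E)%E.
Proof. by rewrite integral_indic// setIT. Qed.

Lemma progeny_gt_ub x n k L : (0 < n)%N ->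
  (P (progeny_gt x n k) <= \int[P]_w (crossing L k x w)%:E +
    (n%:R^-1 ^+ 2)%:E * \int[P]_w (N L k x w ^+ 2)%:E)%E.
Proof.
move=> n0; have n0' : 0 < n%:R :> R by rewrite ltr0n.
have c0 w : setT w -> (0 <= (crossing L k x w)%:E)%E by rewrite lee_fin C_ge0.
have s0 w : setT w -> (0 <= (N L k x w ^+ 2)%:E)%E by rewrite lee_fin sqr_ge0.
have n20 : (0 <= (n%:R^-1 ^+ 2 : R)%:E)%E by rewrite lee_fin sqr_ge0.
have ms := measurable_funeM (n%:R^-1 ^+ 2)%:E (mN2 L k x).
have ns0 w : setT w -> (0 <= (n%:R^-1 ^+ 2)%:E * (N L k x w ^+ 2)%:E)%E.
  by move=> wT; rewrite mule_ge0// s0.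
rewrite -(ge0_integralZl P measurableT (mN2 L k x) s0 n20).
rewrite -(ge0_integralD P measurableT c0 (mC L k x) ns0 ms).
rewrite P_indic.
apply: ge0_le_integral => //.
- exact/measurable_EFinP/measurable_indic.
- by apply: emeasurable_funD => //; exact: measurable_funeM.
move=> w _; rewrite -EFinM -EFinD lee_fin indicE.
have [/set_mem h|_] := boolP (w \in _); last first.
  by rewrite addr_ge0 ?C_ge0// mulr_ge0// sqr_ge0.
rewrite /progeny_gt /= in h.
have sub1 : `[0, L]%classic `<=` [set z : R | 0 <= z].
  by move=> z /=; rewrite in_itv/= => /andP[].
have [E|h1] := branch_confined [set z : R | 0 <= z] L k x [::] (fun u => Xs u w) sub1 (fun z => id).
  rewrite E in h; apply: ler_wpDl => //.
  by rewrite -exprMn exprn_ege1// ler_pdivlMl// mulr1 ltW.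
by apply: (le_trans h1); rewrite lerDl mulr_ge0// sqr_ge0.
Qed.

Lemma progeny_gt_lb x n k (j l A Q S : R) : j <= l -> 0 < A -> 0 < S ->
  (A%:E + \int[P]_w (N j k x w)%:E <= \int[P]_w (N l k x w)%:E)%E ->
  (\int[P]_w (crossing j k x w)%:E <= Q%:E)%E ->
  (\int[P]_w (N l k x w ^+ 2)%:E <= S%:E)%E ->
  (\int[P]_w (N l k x w)%:E < +oo)%E ->
  n%:R * Q <= A / 4 ->
  ((A ^+ 2 / (2 * S))%:E <= P (progeny_gt x n k))%E.
Proof.
move=> jl A0 S0 hA hQ hS Nfin hnQ.
pose m := A / (2 * S).
have m0 : 0 < m by rewrite divr_gt0// mulr_gt0.
have mS : m * S = A / 2 by rewrite /m; field; rewrite gt_eqF.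
have dom w : N l k x w <= N j k x w + (n%:R * crossing j k x w +
   (m / 2 * (N l k x w ^+ 2) + (2 * m)^-1 * \1_(progeny_gt x n k) w)).
  have Nj0 := N_ge0 j k x w; have Nl0 := N_ge0 l k x w; have Cj0 := C_ge0 j k x w.
  have n0 : 0 <= n%:R :> R by [].
  have sq0 : 0 <= m / 2 * N l k x w ^+ 2 by rewrite mulr_ge0 ?sqr_ge0// divr_ge0// ltW.
  have i0 : 0 <= (2 * m)^-1 * \1_(progeny_gt x n k) w.
    by rewrite mulr_ge0 ?I0// ?invr_ge0 ?indicE// mulr_ge0// ltW.
  have nC0 : 0 <= n%:R * crossing j k x w by rewrite mulr_ge0.
  have sub1 : `[0, j]%classic `<=` `[0, l]%classic.
    by move=> z /=; rewrite !in_itv/= => /andP[-> zj]; exact: le_trans jl.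
  have sub2 : `[0, l]%classic `<=` [set z : R | 0 <= z].
    by move=> z /=; rewrite in_itv/= => /andP[].
  have [E|h1] := branch_confined `[0, l]%classic j k x [::] (fun u => Xs u w) sub1 sub2.
    lra.
  have [Nn|nN] := leP (N l k x w) n%:R.
    have : n%:R <= n%:R * crossing j k x w by rewrite ler_peMr.
    lra.
  have ind1 : \1_(progeny_gt x n k) w = 1 :> R.
    rewrite indicE mem_set// /progeny_gt /=; apply: (lt_le_trans nN).
    have ind_le z : 0 <= (\1_`[0, l]%classic z : R) <= \1_[set z : R | 0 <= z] z.
      rewrite I0/= !indicE; case: (boolP (z \in `[0, l]%classic)) => [|_]; last by [].
      by move=> /set_mem/sub2/mem_set ->.
    exact: le_branch.
  rewrite ind1 mulr1 in i0 *.
  have : N l k x w <= m / 2 * N l k x w ^+ 2 + (2 * m)^-1.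
    rewrite -subr_ge0.
    have -> : m / 2 * N l k x w ^+ 2 + (2 * m)^-1 - N l k x w =
      (m * N l k x w - 1) ^+ 2 / (2 * m) by field; rewrite gt_eqF.
    by rewrite divr_ge0 ?sqr_ge0// mulr_ge0// ltW.
  lra.
have mP : measurable_fun setT (fun w => (\1_(progeny_gt x n k) w : R)%:E).
  exact/measurable_EFinP/measurable_indic.
have P0 w : (0 <= (\1_(progeny_gt x n k) w : R)%:E)%E by rewrite lee_fin indicE.
have mm2 : 0 <= m / 2 by rewrite divr_ge0// ltW.
have m2i : 0 <= (2 * m)^-1 by rewrite invr_ge0 mulr_ge0// ltW.
have h : (\int[P]_w (N l k x w)%:E <= \int[P]_w (N j k x w)%:E +
   (n%:R%:E * \int[P]_w (crossing j k x w)%:E +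
   ((m / 2)%:E * \int[P]_w (N l k x w ^+ 2)%:E +
   ((2 * m)^-1)%:E * P (progeny_gt x n k))))%E.
  rewrite P_indic.
  have p1 w : setT w -> (0 <= (N j k x w)%:E)%E by rewrite lee_fin N_ge0.
  have p2 w : setT w -> (0 <= (crossing j k x w)%:E)%E by rewrite lee_fin C_ge0.
  have p3 w : setT w -> (0 <= (N l k x w ^+ 2)%:E)%E by rewrite lee_fin sqr_ge0.
  have p4 w : setT w -> (0 <= (\1_(progeny_gt x n k) w : R)%:E)%E by [].
  rewrite -!ge0_integralZl// ?lee_fin//.
  have q2 w : setT w -> (0 <= n%:R%:E * (crossing j k x w)%:E)%E.
    by move=> wT; rewrite mule_ge0 ?p2// lee_fin.
  have q3 w : setT w -> (0 <= (m / 2)%:E * (N l k x w ^+ 2)%:E)%E.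
    by move=> wT; rewrite mule_ge0 ?p3// lee_fin.
  have q4 w : setT w -> (0 <= ((2 * m)^-1)%:E * (\1_(progeny_gt x n k) w : R)%:E)%E.
    by move=> wT; rewrite mule_ge0 ?p4// lee_fin.
  have r2 : measurable_fun setT (fun w => n%:R%:E * (crossing j k x w)%:E)%E.
    exact: measurable_funeM.
  have r3 : measurable_fun setT (fun w => (m / 2)%:E * (N l k x w ^+ 2)%:E)%E.
    exact: measurable_funeM.
  have r4 : measurable_fun setT (fun w => ((2 * m)^-1)%:E * (\1_(progeny_gt x n k) w : R)%:E)%E.
    exact: measurable_funeM.
  have r34 := emeasurable_funD r3 r4; have r234 := emeasurable_funD r2 r34.
  have q34 w : setT w -> (0 <= (m / 2)%:E * (N l k x w ^+ 2)%:E +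
      ((2 * m)^-1)%:E * (\1_(progeny_gt x n k) w : R)%:E)%E.
    by move=> wT; rewrite adde_ge0 ?q3 ?q4.
  rewrite -(ge0_integralD P measurableT q3 r3 q4 r4).
  rewrite -(ge0_integralD P measurableT q2 r2 q34 r34).
  rewrite -ge0_integralD//; last first.
    by move=> w wT; rewrite adde_ge0 ?q2 ?q34.
  apply: ge0_le_integral => //.
  - by move=> w _; rewrite lee_fin N_ge0.
  - exact: emeasurable_funD.
  move=> w _; rewrite -!EFinM -!EFinD lee_fin; exact: dom.
have jfin : (\int[P]_w (N j k x w)%:E)%E \is a fin_num.
  rewrite ge0_fin_numE; last by apply: integral_ge0 => w _; rewrite lee_fin.
  apply: le_lt_trans Nfin; apply: le_trans hA; rewrite leeDr// lee_fin ltW//.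
have pfin : P (progeny_gt x n k) \is a fin_num by rewrite fin_num_measure.
have := le_trans hA h.
rewrite [X in (X <= _)%E]addeC leeD2lE// => h'.
have := le_trans h' (leeD (lee_wpmul2l _ hQ) (leeD2r _ (lee_wpmul2l _ hS))).
rewrite !lee_fin -(fineK pfin) -!EFinM -!EFinD !lee_fin => /(_ (ler0n _ _) mm2) h2.
have h3 : A / 2 <= (2 * m)^-1 * fine (P (progeny_gt x n k)).
  have : m / 2 * S = A / 4 by rewrite mulrAC mS; field.
  lra.
rewrite ler_pdivlMl in h3; last by rewrite mulr_gt0.
apply: le_trans h3; rewrite /m le_eqVlt; apply/orP; left; apply/eqP.
by field; rewrite gt_eqF.
Qed.

End tail.

Lemma maxr_ge_affine {R : realType} (a x : R) : 0 < a -> 0 <= x ->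
  a / (1 + a) * (1 + x) <= Num.max x a.
Proof.
move=> a0 x0; rewrite mulrAC ler_pdivrMr; last by lra.
have [ax|xa] := leP a x; nra.
Qed.

Section branching_moments.
Context {R : realType} {b : nat}.
Hypothesis hb : (2 <= b)%N.
Context {d0 : measure_display} {T0 : measurableType d0} {P0 : probability T0 R}.
Variable X : {RV P0 >-> R}.
Hypothesis hX : ~ lattice_distribution X.
Variable rho : R.
Hypothesis rho_gt0 : 0 < rho.
Hypothesis rho_int : interior [set t : R | ('M_P0 X t < +oo)%E] rho.
Hypothesis rho_min : forall t : R, ('M_P0 X rho <= 'M_P0 X t)%E.
Hypothesis crit : 'M_P0 X rho = ((b%:R)^-1)%:E.
Context {d : measure_display} {T : measurableType d} {P : probability T R}.
Variable Xs : vertex b -> {RV P >-> R}.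
Hypothesis hXs : iid_with_law [set u : vertex b | u <> tree_root] Xs X.

Local Notation N L k y w :=
  (branch \1_`[0, L]%classic \1_`[0, L]%classic k y [::] (fun u => Xs u w)).
Local Notation crossing L k y w :=
  (branch \1_`]L, +oo[%classic \1_`[0, L]%classic k y [::] (fun u => Xs u w)).

Lemma branching_moments : exists Cu c K : R, [/\ 0 < Cu, 0 < c, 0 <= K,
  (forall L x k, 1 <= L -> 0 <= x <= L ->
    (\int[P]_w (crossing L k x w)%:E <=
       (Cu * ((1 + x) * expR (rho * x)) / (expR (rho * L) * L))%:E)%E /\
    (\int[P]_w (N L k x w ^+ 2)%:E <=
       (Cu * ((1 + x) * expR (rho * x)) * expR (rho * L) / L ^+ 3)%:E)%E /\
    (\int[P]_w (N L k x w)%:E < +oo)%E) &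
  (forall x, 0 <= x -> exists l0, forall l, l0 <= l -> exists k,
    ((c * ((1 + x) * expR (rho * x)) / l ^+ 2)%:E +
      \int[P]_w (N (l - 1 - K) k x w)%:E <= \int[P]_w (N l k x w)%:E)%E)].
Proof.
have [th [m1 [m2 [C [/andP[th0 th1] thr m11 C0 [hm1 hm2 HV HU]]]]]] :=
  tilt_barriers X hX hb rho rho_gt0 rho_int rho_min crit.
have t1 := tilt_mean1 X hb rho crit.
have tid := tilt_mean_id X hb rho rho_int rho_min crit.
have trho := @tilt_mean_rho R b _ _ _ X rho.
have [c3 [c30 tpos]] := tilt_mean_pos X hX hb rho rho_int rho_min crit.
have thi : 0 < th^-1 by rewrite invr_gt0.
pose K := (1 + th^-1) * `|m2| / ((m1 - 1) * th).
have K0 : 0 <= K.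
  by rewrite divr_ge0// mulr_ge0// ?subr_ge0; lra.
have hK : (1 + th^-1) * m2 * expR (- (th * K)) <= m1 - 1.
  rewrite expRN ler_pdivrMr ?expR_gt0//.
  apply: (@le_trans _ _ ((1 + th^-1) * `|m2|)).
    by apply: ler_wpM2l; [lra|exact: ler_norm].
  have -> : (1 + th^-1) * `|m2| = (m1 - 1) * (th * K).
    by rewrite /K; field; rewrite !gt_eqF//; lra.
  by apply: ler_wpM2l; [lra|have := expR_ge1Dx (th * K); lra].
pose Cf := 1 + expR (th * K).
have Cf0 : 0 < Cf by rewrite addr_gt0 ?expR_gt0.
have slope0 : 0 < @slope R b rho.
  rewrite invr_gt0 mulr_gt0//; first by rewrite ltr0n (ltn_trans _ hb).
  by rewrite addr_gt0 ?invr_gt0.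
pose a0 := c3 / 2.
have a00 : 0 < a0 by rewrite divr_gt0.
pose c5 := a0 / (1 + a0).
have c50 : 0 < c5 by rewrite divr_gt0//; lra.
exists (m1 * C + 4 * C ^+ 3 / th ^+ 2), (@slope R b rho / Cf * (c5 / 2)), K.
have A1 : 0 < m1 * C by rewrite mulr_gt0//; lra.
have A2 : 0 < 4 * C ^+ 3 / th ^+ 2.
  by rewrite divr_gt0 ?exprn_gt0// mulr_gt0 ?exprn_gt0.
split => //.
- exact: addr_gt0.
- by rewrite mulr_gt0 ?(divr_gt0 slope0)// divr_gt0.
- move=> L x k L1 /[dup] xI /andP[x0 xL]; have L0 : 0 < L by lra.
  have [V [hV bV]] := HV L L1; have [U [hU bU]] := HU L L1.
  have q0 : 0 <= (1 + x) * expR (rho * x) by rewrite mulr_ge0 ?expR_ge0//; lra.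
  split; last split.
  + apply: le_trans (crossing_ub X Xs hXs rho th m1 rho_gt0 th0 hm1 L U hU k x [::]) _.
    rewrite lee_fin.
    have -> : \1_`]L, +oo[%classic x = 0 :> R.
      by rewrite indicE memNset//= in_itv/= andbT ltNge xL.
    rewrite add0r expRN.
    apply: (@le_trans _ _ (m1 * C * ((1 + x) * expR (rho * x)) / (expR (rho * L) * L))).
      have -> : m1 * C * ((1 + x) * expR (rho * x)) / (expR (rho * L) * L) =
          expR (rho * x) * (m1 / expR (rho * L) * (C * (x + 1) / L)).
        by field; rewrite !gt_eqF ?expR_gt0.
      apply: ler_wpM2l; first exact: expR_ge0.
      by apply: ler_wpM2l; [rewrite divr_ge0 ?expR_ge0//; lra|exact: bU].
    apply: ler_wpM2r; first by rewrite invr_ge0 mulr_ge0 ?expR_ge0// ltW.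
    by apply: ler_wpM2r => //; lra.
  + apply: le_trans (second_moment_ub X Xs hXs rho th C th0 th1 thr C0 L V U L1 hV bV hU k x [::]) _.
    rewrite lee_fin.
    apply: (@le_trans _ _ (4 * C ^+ 3 / th ^+ 2 * ((1 + x) * expR (rho * x)) *
        expR (rho * L) / L ^+ 3)).
      have -> : 4 * C ^+ 3 / th ^+ 2 * ((1 + x) * expR (rho * x)) * expR (rho * L) / L ^+ 3 =
          expR (rho * x) * (4 * C ^+ 2 / th ^+ 2 * (expR (rho * L) / L ^+ 2) *
          (C * (x + 1) / L)).
        by field; rewrite !gt_eqF.
      apply: ler_wpM2l; first exact: expR_ge0.
      apply: ler_wpM2l; last exact: bU.
      apply: mulr_ge0; last by rewrite divr_ge0 ?expR_ge0 ?sqr_ge0.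
      by rewrite divr_ge0 ?sqr_ge0// mulr_ge0 ?sqr_ge0.
    apply: ler_wpM2r; first by rewrite invr_ge0 exprn_ge0// ltW.
    apply: ler_wpM2r; first exact: expR_ge0.
    by apply: ler_wpM2r => //; lra.
  + exact: le_lt_trans (EN_ub X Xs hXs rho th th0 thr L V hV k x [::]) (ltry _).
- move=> x x0.
  pose M := th^-1 * expR (th * x) ^+ 2 * `|m2| / a0.
  have M0 : 0 <= M.
    by rewrite divr_ge0 ?(ltW a00)// !mulr_ge0 ?sqr_ge0// ltW.
  exists (1 + K + x + M / th) => l hl.
  have Mt : 0 <= M / th by rewrite divr_ge0// ltW.
  have l1 : 1 <= l by lra.
  have l0 : 0 < l by lra.
  have [V [hV bV]] := HV l l1.
  have xI : 0 <= x <= l - 1 - K by rewrite x0/=; lra.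
  have ha : ((c5 * (1 + x))%:E <=
      \int[P0]_w (@tilt R b _ _ _ X rho w * hump th l K (x + X w))%:E)%E.
    have [xa|ax] := leP x a0.
      apply: le_trans (hump_mean_origin X rho th m2 th0 c3 hm2 tpos l K l1 x x0).
      rewrite lee_fin; have := maxr_ge_affine a0 x a00 x0; rewrite max_r// => h.
      apply: (le_trans h).
      suff : th^-1 * expR (- (th * (l - 1))) * expR (th * x) ^+ 2 * m2 <= a0.
        rewrite /a0; lra.
      apply: (@le_trans _ _ (th^-1 * expR (th * x) ^+ 2 * `|m2| * expR (- (th * (l - 1))))).
        have -> : th^-1 * expR (- (th * (l - 1))) * expR (th * x) ^+ 2 * m2 =
          th^-1 * expR (th * x) ^+ 2 * expR (- (th * (l - 1))) * m2 by ring.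
        rewrite -[leRHS]mulrA [X in _ <= _ * X]mulrC [leRHS]mulrA.
        apply: ler_wpM2l; last exact: ler_norm.
        by rewrite !mulr_ge0 ?sqr_ge0 ?expR_ge0// ltW.
      rewrite expRN ler_pdivrMr ?expR_gt0//.
      have -> : th^-1 * expR (th * x) ^+ 2 * `|m2| = a0 * M.
        by rewrite /M; field; rewrite !gt_eqF.
      apply: ler_wpM2l; first exact: ltW.
      have : M <= th * (l - 1) by rewrite mulrC -ler_pdivrMr//; lra.
      have := expR_ge1Dx (th * (l - 1)); lra.
    apply: le_trans (hump_mean X rho th m1 m2 th0 th1 hm1 t1 tid hm2 l K l1 m11 K0 hK x xI).
    rewrite lee_fin; have := maxr_ge_affine a0 x a00 x0; rewrite (max_l (ltW ax)) => h.
    by apply: (le_trans h); apply: hump_ge => //; have /andP[-> _] := xI; lra.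
  have a0' : 0 < c5 * (1 + x) by rewrite mulr_gt0//; lra.
  have [k hk] := EN_gap_start X Xs hXs rho th m1 m2 C rho_gt0 th0 th1 thr C0 hm1 hb t1 tid
    trho hm2 l K V l1 m11 K0 hK hV bV x _ xI a0' ha.
  exists k; apply: le_trans hk; rewrite leeD2r// lee_fin le_eqVlt; apply/orP; left; apply/eqP.
  by rewrite /scale -/Cf; field; rewrite !gt_eqF.
Qed.

End branching_moments.

Lemma eventually_ln_ge {R : realType} (B : R) :
  exists n0 : nat, forall n, (n0 <= n)%N -> (0 < n)%N /\ B <= ln (n%:R : R).
Proof.
exists (Num.truncn (expR B)).+1 => n hn.
have n0 : (0 < n)%N by exact: leq_trans hn.
split => //; rewrite -[B]expRK ler_ln ?posrE ?expR_gt0 ?ltr0n//.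
by apply: le_trans (ltW (truncnS_gt _)) _; rewrite ler_nat.
Qed.

Theorem theorem1p1
  (R : realType) (b : nat) (hb : (2 <= b)%N)
  (d0 : measure_display) (T0 : measurableType d0) (P0 : probability T0 R)
  (X : {RV P0 >-> R}) (hX : ~ lattice_distribution X)
  (rho : R) (rho_gt0 : 0 < rho)
  (rho_int : interior [set t : R | ('M_P0 X t < +oo)%E] rho)
  (rho_min : forall t : R, ('M_P0 X rho <= 'M_P0 X t)%E)
  (crit : 'M_P0 X rho = ((b%:R)^-1)%:E)
  (d : measure_display) (T : measurableType d) (P : probability T R)
  (Xs : vertex b -> {RV P >-> R})
  (hXs : iid_with_law [set u : vertex b | u <> tree_root] Xs X) :
  exists C1 C2 : R, 0 < C1 /\ 0 < C2 /\
    forall x : R, 0 <= x ->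
      exists n0 : nat, forall n : nat, (n0 <= n)%N ->
        ((C1 * ((1 + x) * expR (rho * x) / (n%:R * ln n%:R ^+ 2)))%:E
           <= P [set w | (n%:R%:E < total_progeny x (fun u => Xs u w))%E])%E
        /\
        (P [set w | (n%:R%:E < total_progeny x (fun u => Xs u w))%E]
           <= (C2 * ((1 + x) * expR (rho * x) / (n%:R * ln n%:R ^+ 2)))%:E)%E.
Proof.
have [Cu [c [K [Cu0 c0 K0 hup hlow]]]] :=
  branching_moments hb X hX rho rho_gt0 rho_int rho_min crit Xs hXs.
pose M := 1 + 24 * Cu * expR (rho * (1 + K)) / (rho * c).
have Mq0 : 0 <= 24 * Cu * expR (rho * (1 + K)) / (rho * c).
  by rewrite divr_ge0 ?mulr_ge0 ?expR_ge0// ltW.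
have M1 : 1 <= M by rewrite lerDl.
have M0 : 0 < M by lra.
exists (c ^+ 2 * rho / (6 * Cu * M)), (Cu * (rho + rho ^+ 3)).
split; first by rewrite divr_gt0 ?mulr_gt0 ?exprn_gt0.
split; first by rewrite mulr_gt0// addr_gt0// exprn_gt0.
move=> x x0.
have [l0 hl0] := hlow x x0.
pose B := 1 + rho + rho * x + `|rho * l0| + ln M + rho * (2 * (1 + K) + x + 1).
have [n0 hn0] := eventually_ln_ge B.
exists n0 => n hn; have [n_gt0 hB] := hn0 n hn.
have n0' : 0 < n%:R :> R by rewrite ltr0n.
set q := (1 + x) * expR (rho * x).
have q0 : 0 < q by rewrite mulr_gt0 ?expR_gt0//; lra.
set lam := ln n%:R in hB *.
have lnM0 : 0 <= ln M by rewrite ln_ge0.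
have rx0 : 0 <= rho * x by rewrite mulr_ge0// ltW.
have rK0 : 0 <= rho * (2 * (1 + K) + x + 1) by rewrite mulr_ge0// ?ltW//; lra.
have rl0 := normr_ge0 (rho * l0).
have lam1 : 1 <= lam by move: hB; rewrite /B; lra.
have lam0 : 0 < lam by lra.
have enl : expR lam = n%:R by rewrite /lam lnK ?posrE.
split.
- pose l := (ln M + lam + ln lam) / rho.
  have lnl0 : 0 <= ln lam by rewrite ln_ge0.
  have lnl1 : ln lam <= lam by rewrite ltW// ln_sublinear.
  have rl : rho * l = ln M + lam + ln lam by rewrite /l mulrC divfK// gt_eqF.
  have el : expR (rho * l) = M * n%:R * lam.
    by rewrite rl !expRD enl !lnK ?posrE.
  have lB (z : R) : rho * z <= B -> z <= l.
    move=> hz; rewrite -(ler_pM2l rho_gt0) rl; lra.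
  have ll0 : l0 <= l by apply: lB; rewrite /B; have := ler_norm (rho * l0); lra.
  have lK : 2 * (1 + K) + x + 1 <= l by apply: lB; rewrite /B; lra.
  have l1 : 1 <= l by lra.
  have l_gt0 : 0 < l by lra.
  have l3 : rho * l <= 3 * lam by rewrite rl; move: hB; rewrite /B; lra.
  have [k hk] := hl0 l ll0.
  pose j := l - 1 - K.
  have jl2 : l / 2 <= j by rewrite /j; lra.
  have j0 : 0 < j by apply: lt_le_trans jl2; rewrite divr_gt0.
  have j1 : 1 <= j by rewrite /j; lra.
  have xj : 0 <= x <= j by rewrite x0 /j /=; lra.
  have xl : 0 <= x <= l by rewrite x0 /=; lra.
  have [hC _] := hup j x k j1 xj.
  have [_ [hS hfin]] := hup l x k l1 xl.
  have jl : j <= l by rewrite /j; lra.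
  set A := c * q / l ^+ 2 in hk.
  have A0 : 0 < A by rewrite /A; apply: divr_gt0; [exact: mulr_gt0|exact: exprn_gt0].
  set Q := Cu * q / (expR (rho * j) * j) in hC.
  set S := Cu * q * expR (rho * l) / l ^+ 3 in hS.
  have S0 : 0 < S by rewrite /S; apply: divr_gt0; [apply: mulr_gt0; [exact: mulr_gt0|exact: expR_gt0]|exact: exprn_gt0].
  have hQ : n%:R * Q <= A / 4.
    have ej : expR (rho * j) * expR (rho * (1 + K)) = M * n%:R * lam.
      by rewrite -expRD -el; congr expR; rewrite /j; ring.
    set g := expR (rho * (1 + K)) in ej *.
    have g0 : 0 < g by exact: expR_gt0.
    have QE : n%:R * Q = Cu * q * g / (M * lam * j).
      have ej0 := expR_gt0 (rho * j).
      have -> : M * lam * j = expR (rho * j) * g * j / n%:R.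
        by rewrite ej; field; rewrite gt_eqF.
      by rewrite /Q; field; rewrite !gt_eqF.
    rewrite QE ler_pdivrMr ?mulr_gt0//.
    have -> : A / 4 * (M * lam * j) = q * (c * M * lam * j / (4 * l ^+ 2)).
      by rewrite /A; field; rewrite gt_eqF.
    rewrite [Cu * q]mulrC -[leLHS]mulrA; apply: ler_wpM2l; first exact: ltW.
    have Mc : 24 * Cu * g <= M * (rho * c).
      rewrite -ler_pdivrMr ?mulr_gt0// /M -/g; lra.
    rewrite ler_pdivlMr; last by rewrite mulr_gt0 ?exprn_gt0.
    apply: (@le_trans _ _ (M * (rho * c) / 6 * l ^+ 2)).
      have : 0 <= l ^+ 2 by exact: sqr_ge0.
      nra.
    apply: (@le_trans _ _ (c * M * lam * (l / 2))); last first.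
      by apply: ler_wpM2l => //; apply/ltW; rewrite !mulr_gt0.
    have : 0 <= c * M * l * (3 * lam - rho * l).
      by apply: mulr_ge0; [exact: ltW (mulr_gt0 (mulr_gt0 c0 M0) l_gt0)|rewrite subr_ge0].
    rewrite expr2; lra.
  have := progeny_gt_lb Xs x n k j l A Q S jl A0 S0 hk hC hS hfin hQ.
  move=> h; apply: le_trans (le_trans h (progeny_tail_lb Xs x n k)).
  rewrite lee_fin.
  have -> : A ^+ 2 / (2 * S) = c ^+ 2 / (2 * Cu * M) * q / (n%:R * lam) / l.
    by rewrite /A /S el; field; rewrite !gt_eqF.
  have -> : c ^+ 2 * rho / (6 * Cu * M) * (q / (n%:R * lam ^+ 2)) =
      c ^+ 2 / (2 * Cu * M) * q / (n%:R * lam) * (rho / (3 * lam)).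
    by field; rewrite !gt_eqF.
  have cCM : 0 < c ^+ 2 / (2 * Cu * M) by rewrite divr_gt0 ?exprn_gt0// !mulr_gt0.
  apply: ler_wpM2l; first by apply/ltW/divr_gt0; exact: mulr_gt0.
  by rewrite -[leRHS]div1r ler_pdivlMr// mulrAC ler_pdivrMr ?mul1r// mulr_gt0.
- pose L := (lam + ln lam) / rho.
  have lnl0 : 0 <= ln lam by rewrite ln_ge0.
  have rL : rho * L = lam + ln lam by rewrite /L mulrC divfK// gt_eqF.
  have eL : expR (rho * L) = n%:R * lam by rewrite rL expRD enl lnK ?posrE.
  have LB (z : R) : rho * z <= lam -> z <= L.
    move=> hz; rewrite -(ler_pM2l rho_gt0) rL; lra.
  have xL : 0 <= x <= L.
    by rewrite x0; apply: LB; move: hB; rewrite /B; lra.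
  have L1 : 1 <= L by apply: LB; move: hB; rewrite /B; lra.
  have L0 : 0 < L by lra.
  have rlL : lam <= rho * L by rewrite rL; lra.
  apply: progeny_tail_ub => k.
  have [hC [hS _]] := hup L x k L1 xL.
  apply: le_trans (progeny_gt_ub Xs x n k L n_gt0) _.
  have n20 : (0 <= (n%:R^-1 ^+ 2 : R)%:E)%E by rewrite lee_fin sqr_ge0.
  apply: le_trans (leeD hC (lee_wpmul2l n20 hS)) _.
  rewrite -EFinM -EFinD lee_fin -/q eL.
  have -> : Cu * q / (n%:R * lam * L) + n%:R^-1 ^+ 2 * (Cu * q * (n%:R * lam) / L ^+ 3) =
      Cu * (q / (n%:R * lam ^+ 2)) * (lam / L + (lam / L) ^+ 3).
    by field; rewrite !gt_eqF.
  rewrite [leRHS]mulrAC.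
  have lL : lam / L <= rho by rewrite ler_pdivrMr.
  have lL0 : 0 <= lam / L by rewrite divr_ge0// ltW.
  apply: ler_wpM2l; last by rewrite lerD// lerXn2r// ?nnegrE// ltW.
  apply/ltW/mulr_gt0 => //; apply: divr_gt0 => //.
  by rewrite mulr_gt0 ?exprn_gt0.
Qed.
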